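(* Let $V_1,\ldots,V_k$ be sets and $R\subseteq V_1\times\cdots\times V_k$. For each $i\in[k]$ let $\mathcal B_i$ be a field on $V_i$ containing every fibre $R_b$, $b\in V_{i^\circ}$, and let $\mu_i$ be a measure on $\mathcal B_i$ which is fap on $R$. Let $\mu=\mu_1\ltimes\cdots\ltimes\mu_k$. Then for every $\varepsilon>0$ there is an $R_\otimes$-definable set $A\subseteq V_1\times\cdots\times V_k$ with $\mu(R\,\Delta\,A)<\varepsilon$. In addition, if $R$ has VC-dimension at most $d$, then $A$ can be chosen to be $R_\otimes$-definable over some tuple $\vec D$ with $\|\vec D\|\le C_{k,d}(1/\varepsilon)^{2(k-1)d}$, where $C_{k,d}$ is a constant depending only on $k$ and $d$.
   Context: Notation: $[k]=\{1,\ldots,k\}$; for $I\subseteq[k]$, $I^\circ=[k]\setminus I$, $i^\circ=[k]\setminus\{i\}$, $V_I=\prod_{i\in I}V_i$. Viewing $R$ as a subset of $V_I\times V_{I^\circ}$, for $b\in V_{I^\circ}$ the fibre is $R_b=\{a\in V_I:(a,b)\in R\}$. A set $X\subseteq V_I$ is $R$-definable over $D\subseteq V_{I^\circ}$ if it is a finite Boolean combination of sets $R_b$ with $b\in D$, and $R$-definable if it is $R$-definable over $V_{I^\circ}$. A set $A\subseteq V_1\times\cdots\times V_k$ is $R_\otimes$-definable over $\vec D=(D_1,\ldots,D_k)$ (with $D_i\subseteq V_{i^\circ}$) if it is a finite union of sets $X_1\times\cdots\times X_k$ with each $X_i\subseteq V_i$ $R$-definable over $D_i$; $R_\otimes$-definable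 means $R_\otimes$-definable over some $\vec D$; $\|\vec D\|=\max_i|D_i|$. A field on a set is a Boolean algebra of subsets; a measure on a field is a finitely additive probability measure. A measure $\mu$ on a field $\mathcal B$ on $V$ is fap on a family $\mathcal F\subseteq\mathcal B$ if for every $\varepsilon>0$ there are $p_1,\ldots,p_n\in V$ (repetitions allowed) with $|\mu(F)-\frac1n|\{j:p_j\in F\}||<\varepsilon$ for all $F\in\mathcal F$. For $R\subseteq V\times W$ with all $R_b\in\mathcal B$ ($b\in W$), $\mu$ is fap on $R$ if it is fap on the family of all Boolean combinations of at most $m$ sets $R_b$, for every $m$; for $R\subseteq V_1\times\cdots\times V_k$, ''$\mu_i$ fap on $R$'' means fap on $R$ viewed as a subset of $V_i\times V_{i^\circ}$. Integration: a $\mathcal B$-simple function is a finite combination $\sum r_j\mathbf 1_{X_j}$, $X_j\in\mathcal B$, with $\int\sum r_j\mathbf1_{X_j}d\mu=\sum r_j\mu(X_j)$; a function is $\mathcal B$-integrable if it is a uniform limit of $\mathcal B$-simple functions, and its integral is the limit of the integrals. Product measure: for sets $V,W$, a relation $R\subseteq V\times W\times Z$, a measure $\mu$ on a field $\mathcal B_V$ fap on $R$ (as a subset of $V\times(W\times Z)$) and a measure $\nu$ on a field $\mathcal B_W$ (fields containing the relevant fibres of $R$), $\mu\ltimes\nu$ is the unique measure on the field generated by $\mathcal B_V\otimes\mathcal B_W$ and the fibres $R_c$ ($c\in Z$) which extends the product on boxes and satisfies $(\mu\ltimes\nu)(E\cap(A\times B))=\int_B\mu(A\cap E_y)\,d\nu(y)$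 for all $R$-definable $E\subseteq V\times W$, $A\in\mathcal B_V$, $B\in\mathcal B_W$ (the integrand is $\mathcal B_W$-integrable). Then $\mu_1\ltimes\cdots\ltimes\mu_k$ is defined inductively as $(\mu_1\ltimes\cdots\ltimes\mu_{k-1})\ltimes\mu_k$. A family $\mathcal F$ of subsets of a set has VC-dimension at most $d$ if no set of size $d+1$ is shattered by $\mathcal F$. $R\subseteq V_1\times\cdots\times V_k$ has VC-dimension at most $d$ if for every $I\subseteq[k]$ the family $\{R_a:a\in V_{I^\circ}\}$ of subsets of $V_I$ has VC-dimension at most $d$. *)

(* Defs.v *)
From mathcomp Require Import all_boot all_order all_algebra.
From mathcomp Require Import all_classical all_reals all_analysis.

Set Implicit Arguments.
Unset Strict Implicit.
Unset Printing Implicit Defensive.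

Import Order.TTheory GRing.Theory Num.Theory.
Import numFieldNormedType.Exports.

Local Open Scope classical_set_scope.
Local Open Scope card_scope.
Local Open Scope ring_scope.

(** * Fields of sets and finitely additive probability measures

    Fields and measures are unbundled: a point set carries several fields
    below, each determined by a relation.  A measure on a field [B] is a real
    function on all sets, of which only the values on [B] matter. *)

Definition is_field (T : Type) (B : set (set T)) : Prop :=
  [/\ B setT, setC_closed B & setU_closed B].

Definition gen_field (T : Type) (G : set (set T)) : set (set T) :=
  smallest (@is_field T) G.

Definition is_measure (K : realType) (T : Type) (B : set (set T))
    (mu : set T -> K) : Prop :=
  [/\ mu setT = 1,
      forall A, B A -> 0 <= mu A
    & forall A C, B A -> B C -> A `&` C = set0 ->
        mu (A `|` C) = mu A + mu C].

(** * Definability over a binary relation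

    For [R : set (V * W)] and [b : W], the fibre R_b is [ysection R b].  The
    finite Boolean combinations of a family are the members of the field that
    it generates; those of the empty family are [set0] and [setT]. *)

Definition definable (V W : Type) (R : set (V * W)) (D : set W) :
    set (set V) :=
  gen_field (ysection R @` D).

(** * Frequency interpretations (fap) *)

Definition fap_on (K : realType) (V : Type) (mu : set V -> K)
    (F : set (set V)) : Prop :=
  forall eps : K, 0 < eps ->
    exists n : nat, (0 < n)%N /\ exists p : 'I_n -> V,
      forall A, F A ->
        `|mu A - n%:R^-1 * #|[pred j : 'I_n | p j \in A]|%:R| < eps.

Definition fap (K : realType) (V W : Type) (R : set (V * W))
    (mu : set V -> K) : Prop :=
  forall m : nat,
    fap_on mu [set A | exists D : set W, D #<= `I_m /\ definable R D A].

(** * Integration *)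

(* [g] is a [B]-simple function and [v] is its integral *)
Definition simple_integral (K : realType) (T : Type) (B : set (set T))
    (mu : set T -> K) (g : T -> K) (v : K) : Prop :=
  exists (n : nat) (r : 'I_n -> K) (X : 'I_n -> set T),
    [/\ forall j, B (X j),
        forall x, g x = \sum_(j < n) r j * \1_(X j) x
      & v = \sum_(j < n) r j * mu (X j)].

(* [f] is [B]-integrable and [l] is its integral *)
Definition has_integral (K : realType) (T : Type) (B : set (set T))
    (mu : set T -> K) (f : T -> K) (l : K) : Prop :=
  exists (g : nat -> T -> K) (v : nat -> K),
    [/\ forall n, simple_integral B mu (g n) (v n),
        forall e : K, 0 < e ->
          \forall n \near \oo, forall x, `|f x - g n x| < e
      & v @ \oo --> l].

(** * The product of two measures relative to a relation *)

Definition tensor_field (V W : Type) (BV : set (set V)) (BW : set (set W)) :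
    set (set (V * W)) :=
  gen_field [set E | exists A B, [/\ BV A, BW B & E = A `*` B]].

Definition lprod_field (V W Z : Type) (R : set (V * W * Z))
    (BV : set (set V)) (BW : set (set W)) : set (set (V * W)) :=
  gen_field (tensor_field BV BW `|` range (ysection R)).

(* the integral over B of y |-> mu (A `&` E_y) is that of the integrand
   multiplied by the indicator of B; E_y is [ysection E y] *)
Definition is_lprod (K : realType) (V W Z : Type) (R : set (V * W * Z))
    (BV : set (set V)) (mu : set V -> K) (BW : set (set W)) (nu : set W -> K)
    (m : set (V * W) -> K) : Prop :=
  [/\ is_measure (lprod_field R BV BW) m,
      forall A B, BV A -> BW B -> m (A `*` B) = mu A * nu B
    & forall E A B, definable R setT E -> BV A -> BW B ->
        has_integral BW nu
          (fun y => \1_B y * mu (A `&` ysection E y))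
          (m (E `&` (A `*` B)))].

(* "The" measure satisfying [is_lprod]: unique on [lprod_field R BV BW], and an
   arbitrary choice off that field.  The default 0 is taken if none exists. *)
Definition lprod (K : realType) (V W Z : Type) (R : set (V * W * Z))
    (BV : set (set V)) (mu : set V -> K) (BW : set (set W)) (nu : set W -> K) :
    set (V * W) -> K :=
  xget (fun _ => 0) [set m | is_lprod R BV mu BW nu m].

(** * Relations on finite products

    The number of factors is [n.+1], and they are indexed by ['I_n.+1], so
    that there is at least one; a point of the product is a dependent function
    [forall i, V i]. *)

Section Product.
Variables (n : nat) (V : 'I_n.+1 -> Type).

Definition subprod (I : {set 'I_n.+1}) : Type :=
  forall i : {i : 'I_n.+1 | i \in I}, V (val i).

Definition restr (I : {set 'I_n.+1}) (x : forall i, V i) : subprod I :=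
  fun i => x (val i).
Arguments restr : clear implicits.

(* R as a subset of V_I * V_(~: I), along the bijection x |-> (x|I, x|~: I) *)
Definition rel_at (R : set (forall i, V i)) (I : {set 'I_n.+1}) :
    set (subprod I * subprod (~: I)) :=
  (fun x => (restr I x, restr (~: I) x)) @` R.
Arguments rel_at : clear implicits.

(* R as a subset of V_i * V_(~: {i}) *)
Definition rel_at1 (R : set (forall i, V i)) (i : 'I_n.+1) :
    set (V i * subprod (~: [set i]%SET)) :=
  (fun x => (x i, restr (~: [set i]%SET) x)) @` R.
Arguments rel_at1 : clear implicits.

(* V_0 * ... * V_j, nested to the left.  This is only meant for j <= n, where
   [inord j] is the index j. *)
Fixpoint initprod (j : nat) : Type :=
  if j is j'.+1 then (initprod j' * V (inord j'.+1))%type else V ord0.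

Fixpoint initproj (j : nat) (x : forall i, V i) : initprod j :=
  if j is j'.+1 then (initproj j' x, x (inord j'.+1)) else x ord0.
Arguments initproj : clear implicits.

(* R as a subset of (V_0 * ... * V_j) * (V_(j+1) * ... * V_n) *)
Definition rel_init (R : set (forall i, V i)) (j : nat) :
    set (initprod j * subprod [set i : 'I_n.+1 | (j < i)%N]%SET) :=
  (fun x => (initproj j x, restr [set i : 'I_n.+1 | (j < i)%N]%SET x)) @` R.
Arguments rel_init : clear implicits.

Variables (K : realType) (R : set (forall i, V i)).
Variables (B : forall i, set (set (V i))) (mu : forall i, set (V i) -> K).

Fixpoint init_field (j : nat) : set (set (initprod j)) :=
  match j return set (set (initprod j)) with
  | 0 => @B ord0
  | j'.+1 =>
      lprod_field (rel_init R j'.+1 : set (initprod j' * V (inord j'.+1) * _))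
        (@init_field j') (@B (inord j'.+1))
  end.

Fixpoint init_measure (j : nat) : set (initprod j) -> K :=
  match j return set (initprod j) -> K with
  | 0 => @mu ord0
  | j'.+1 =>
      lprod (rel_init R j'.+1 : set (initprod j' * V (inord j'.+1) * _))
        (@init_field j') (@init_measure j')
        (@B (inord j'.+1)) (@mu (inord j'.+1))
  end.

(* The iterated product of the mu_i, carried over to [forall i, V i] along the
   bijection [initproj n]. *)
Definition iter_lprod (E : set (forall i, V i)) : K :=
  init_measure (initproj n @` E).

Definition tensor_definable
    (D : forall i : 'I_n.+1, set (subprod (~: [set i]%SET)))
    (A : set (forall i, V i)) : Prop :=
  exists (N : nat) (X : 'I_N -> forall i, set (V i)),
    (forall j i, definable (rel_at1 R i) (D i) (X j i)) /\
    A = [set x | exists j : 'I_N, forall i, X j i (x i)].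

(* max_i |D_i| <= c; in particular every D_i is finite *)
Definition tuple_norm_le
    (D : forall i : 'I_n.+1, set (subprod (~: [set i]%SET))) (c : K) : Prop :=
  forall i, exists m : nat, D i #<= `I_m /\ m%:R <= c.

End Product.

Arguments restr {n V} I x.
Arguments initproj {n V} j x.
Arguments rel_at {n V} R I.
Arguments rel_at1 {n V} R i.
Arguments rel_init {n V} R j.

(** * VC-dimension *)

Definition shatters (T : Type) (F : set (set T)) (S : set T) : Prop :=
  forall S', S' `<=` S -> exists X, F X /\ X `&` S = S'.

Definition vc_dim_le (T : Type) (F : set (set T)) (d : nat) : Prop :=
  forall S : set T, S #= `I_d.+1 -> ~ shatters F S.

Definition rel_vc_dim_le (n : nat) (V : 'I_n.+1 -> Type)
    (R : set (forall i, V i)) (d : nat) : Prop :=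
  forall I : {set 'I_n.+1}, vc_dim_le (range (ysection (rel_at R I))) d.

(* Main.v *)
Require Import Defs.
From mathcomp Require Import all_boot all_order all_algebra.
From mathcomp Require Import all_classical all_reals all_analysis.
From mathcomp Require Import lra ring zify.

Set Implicit Arguments.
Unset Strict Implicit.
Unset Printing Implicit Defensive.

Import Order.TTheory GRing.Theory Num.Theory.
Import numFieldNormedType.Exports.

Local Open Scope classical_set_scope.
Local Open Scope ring_scope.

(** Induction on the number of factors.  Write V for the product of all factors
    but the last one, W, and view R in V * W.  Since the measure on V is fap, it
    may be replaced, for distances between fibres R_y, by the counting measure of
    finitely many points.  A random sample of m = O(eps^-2) of these points
    separates almost all pairs of fibres at distance >= eps/2, so choosing one
    representative b in each class of fibres with the same trace on the sample
    gives a partition of W into sets W_b, definable over the sample, with R_y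
    within eps of R_b for y in W_b outside a set of measure at most eps.  Hence R
    is close to the union of the R_b * W_b, and induction applies to each R_b.
    By the Sauer-Shelah lemma there are at most (m + 1)^d = O(eps^(-2d)) classes,
    so each step multiplies the number of parameters by O(eps^(-2d)).

    The existence of the product measures is never needed: if some product did
    not exist, [iter_lprod] would be identically 0. *)

(** * Fields, measures and integrals *)

Section Fields.
Variable T : Type.
Implicit Types (B G : set (set T)) (A C : set T).

Lemma gen_field_is_field G : is_field (gen_field G).
Proof.
split=> [M [[]] //|A hA M hM|A C hA hC M hM].
- by case: (hM) => -[_ hC _] _; apply: hC; apply: hA.
- by case: (hM) => -[_ _ hU] _; apply: hU; [apply: hA|apply: hC].
Qed.

Lemma sub_gen_field G : G `<=` gen_field G.
Proof. by move=> A hA M [_]; apply. Qed.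

Lemma gen_field_min B G : is_field B -> G `<=` B -> gen_field G `<=` B.
Proof. by move=> hB hG A; apply. Qed.

Lemma gen_field_mono G G' : G `<=` G' -> gen_field G `<=` gen_field G'.
Proof.
move=> h; apply: gen_field_min; first exact: gen_field_is_field.
by apply: subset_trans h _; apply: sub_gen_field.
Qed.

Variable B : set (set T).
Hypothesis hB : is_field B.

Lemma fieldT : B setT. Proof. by case: hB. Qed.
Lemma fieldC A : B A -> B (~` A). Proof. by case: hB => _ h _; apply: h. Qed.
Lemma fieldU A C : B A -> B C -> B (A `|` C).
Proof. by case: hB => _ _ h; apply: h. Qed.
Lemma field0 : B set0. Proof. by rewrite -setCT; apply/fieldC/fieldT. Qed.
Lemma fieldI A C : B A -> B C -> B (A `&` C).
Proof. by move=> hA hC; rewrite -[X in B X]setCK setCI; apply/fieldC/fieldU; apply/fieldC. Qed.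
Lemma fieldD A C : B A -> B C -> B (A `\` C).
Proof. by move=> hA hC; rewrite setDE; apply/fieldI/fieldC. Qed.
Lemma fieldY A C : B A -> B C -> B (A `+` C).
Proof. by move=> hA hC; apply/fieldU; apply/fieldD. Qed.

Lemma field_bigcup_seq (I : eqType) (s : seq I) (F : I -> set T) :
  (forall i, B (F i)) -> B [set x | exists2 i, i \in s & F i x].
Proof.
move=> hF; elim: s => [|a s IH].
  rewrite (_ : [set x | _] = set0); first exact: field0.
  by apply/seteqP; split=> // x [].
rewrite (_ : [set x | _] = F a `|` [set x | exists2 i, i \in s & F i x]).
  exact: fieldU.
apply/seteqP; split=> x /=.
  by move=> [i]; rewrite inE => /orP[/eqP->|hi] h; [left|right; exists i].
by move=> [h|[i hi h]]; [exists a; rewrite ?mem_head|exists i; rewrite // inE hi orbT].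
Qed.

Lemma field_bigcup (I : finType) (P : pred I) (F : I -> set T) :
  (forall i, B (F i)) -> B [set x | exists2 i, P i & F i x].
Proof.
move=> /(@field_bigcup_seq _ (enum P)).
rewrite (_ : [set x | exists2 i, i \in enum P & _] = [set x | exists2 i, P i & F i x]) //.
by apply/seteqP; split=> x [i hi h]; exists i; move: hi => //; rewrite mem_enum.
Qed.

Lemma field_bigcap (I : finType) (F : I -> set T) :
  (forall i, B (F i)) -> B [set x | forall i, F i x].
Proof.
move=> hF.
have /fieldC : B [set x | exists2 i, predT i & (~` F i) x].
  by apply: field_bigcup => i; apply/fieldC.
rewrite (_ : ~` _ = [set x | forall i, F i x]) //.
apply/seteqP; split=> x /= h; last by move=> [i _]; apply.
by move=> i; apply: contrapT => hn; apply: h; exists i.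
Qed.

End Fields.

(** The sets whose preimage lies in [B] form a field. With [f] the inclusion of a slice, sections of
    definable sets become definable. *)
Lemma gen_field_preimage (T U : Type) (f : T -> U) (G : set (set U))
    (B : set (set T)) : is_field B -> (forall X, G X -> B (f @^-1` X)) ->
  forall E, gen_field G E -> B (f @^-1` E).
Proof.
move=> hB hG; apply: (@gen_field_min _ [set E | B (f @^-1` E)]) => //.
split=> /=; first by rewrite preimage_setT; apply: fieldT.
- by move=> A /= hA; rewrite preimage_setC; apply: fieldC.
- by move=> A C /= hA hC; rewrite preimage_setU; apply: fieldU.
Qed.

Section Measures.
Variables (K : realType) (T : Type) (B : set (set T)) (mu : set T -> K).
Hypotheses (hB : is_field B) (hmu : is_measure B mu).
Implicit Types A C : set T.

Lemma measureT : mu setT = 1. Proof. by case: hmu. Qed.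
Lemma fmeasure_ge0 A : B A -> 0 <= mu A. Proof. by case: hmu => _ h _; apply: h. Qed.
Lemma fmeasureU A C : B A -> B C -> A `&` C = set0 -> mu (A `|` C) = mu A + mu C.
Proof. by case: hmu => _ _ h; apply: h. Qed.

Lemma fmeasure0 : mu set0 = 0.
Proof.
have := fmeasureU (field0 hB) (field0 hB) (setI0 _).
by rewrite setU0 => h; lra.
Qed.

Lemma fmeasure_le A C : B A -> B C -> A `<=` C -> mu A <= mu C.
Proof.
move=> hA hC hAC; have hD := fieldD hB hC hA.
have := fmeasureU hA hD; rewrite setDE setICA setICr setI0 => /(_ erefl).
rewrite -setDE setDUK // => ->; rewrite lerDl; exact: fmeasure_ge0.
Qed.

Lemma fmeasure_le1 A : B A -> mu A <= 1.
Proof. by move=> hA; rewrite -measureT; apply: fmeasure_le => //; apply: fieldT. Qed.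

Lemma fmeasure_leU A C : B A -> B C -> mu (A `|` C) <= mu A + mu C.
Proof.
move=> hA hC; have hD := fieldD hB hC hA.
have -> : A `|` C = A `|` (C `\` A).
  by apply/seteqP; split=> x /=; have [] := pselect (A x); tauto.
rewrite fmeasureU //; last by rewrite setDE setICA setICr setI0.
by rewrite lerD2l; apply: fmeasure_le => // x [].
Qed.

Lemma fmeasure_nonempty : exists x : T, True.
Proof.
apply: contrapT => h; have : setT = set0 :> set T.
  by apply/seteqP; split=> // x _; apply: h; exists x.
move=> e; have := measureT; rewrite e fmeasure0 => /eqP.
by rewrite eq_sym oner_eq0.
Qed.

Section FinitePartition.
Variables (I : finType) (f : T -> I).
Hypothesis hf : forall i, B (f @^-1` [set i]).

Lemma field_preimage_fin (P : pred I) : B [set x | P (f x)].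
Proof.
have := field_bigcup hB P hf.
rewrite (_ : [set x | exists2 i, _ & _] = [set x | P (f x)]) //.
by apply/seteqP; split=> x /=; [move=> [i Pi ->]|move=> ?; exists (f x)].
Qed.

(** A partition is encoded as a map to a finite type with fibres in the field; the measure then
    becomes a finite weight, the form in which sampling is done. *)
Lemma fmeasure_preimage (P : pred I) :
  mu [set x | P (f x)] = \sum_(i | P i) mu (f @^-1` [set i]).
Proof.
suff H : forall s : seq I, uniq s ->
    mu [set x | f x \in s] = \sum_(i <- s) mu (f @^-1` [set i]).
  have := H (enum P) (enum_uniq _).
  rewrite big_enum /= => <-; congr mu.
  by apply/seteqP; split=> x /=; rewrite mem_enum.
elim=> [_|a s IH /andP[ha hs]].
  by rewrite big_nil -[RHS]fmeasure0; congr mu; apply/seteqP; split.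
rewrite big_cons -IH // -fmeasureU //.
- congr mu; apply/seteqP; split=> x /=; rewrite inE.
    by move=> /orP[/eqP->|]; [left|right].
  by move=> [->|->]; rewrite ?eqxx ?orbT.
- exact: (@field_preimage_fin (mem s)).
- by apply/seteqP; split=> // x /= [-> h]; rewrite h in ha.
Qed.

Lemma sum_fmeasure_preimage : \sum_i mu (f @^-1` [set i]) = 1.
Proof.
by rewrite -(fmeasure_preimage predT) -measureT; congr mu; apply/seteqP; split.
Qed.

End FinitePartition.

Lemma fmeasure_bigcup_le (I : finType) (F : I -> set T) : (forall i, B (F i)) ->
  mu [set x | exists i, F i x] <= \sum_i mu (F i).
Proof.
move=> hF.
suff H : forall s : seq I,
    mu [set x | exists2 i, i \in s & F i x] <= \sum_(i <- s) mu (F i).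
  have := H (enum I); rewrite big_enum /=; apply: le_trans; rewrite le_eqVlt.
  apply/orP; left; apply/eqP; congr mu; apply/seteqP; split=> x /=.
    by move=> [i h]; exists i => //; rewrite mem_enum.
  by move=> [i _ h]; exists i.
elim=> [|a s IH].
  rewrite big_nil -fmeasure0 le_eqVlt; apply/orP; left; apply/eqP; congr mu.
  by apply/seteqP; split=> // x [].
rewrite big_cons; apply: le_trans (lerD (lexx _) IH).
rewrite (_ : [set x | _] = F a `|` [set x | exists2 i, i \in s & F i x]).
  by apply: fmeasure_leU => //; apply: field_bigcup_seq.
apply/seteqP; split=> x /=.
  by move=> [i]; rewrite inE => /orP[/eqP->|hi] h; [left|right; exists i].
by move=> [h|[i hi h]]; [exists a; rewrite ?mem_head|exists i; rewrite // inE hi orbT].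
Qed.

End Measures.

Section Integrals.
Variables (K : realType) (T : Type) (B : set (set T)) (mu : set T -> K).
Hypotheses (hB : is_field B) (hmu : is_measure B mu).

(** The sets [X j] may overlap, so [g] is rewritten over the atoms they generate, which are the
    fibres of [f] below. There [g] is constant, and [v] is a convex combination of its values. *)
Lemma simple_integral_ge g v (c : K) : simple_integral B mu g v ->
  (forall x, c <= g x) -> c <= v.
Proof.
move=> [n [r [X [hX hg ->]]]] hc.
pose f x : {set 'I_n} := [set j | x \in X j]%SET.
have hf i : B (f @^-1` [set i]).
  have := @field_bigcap _ _ hB 'I_n (fun j => if j \in i then X j else ~` X j).
  rewrite (_ : [set x | _] = f @^-1` [set i]).
    by apply=> j; case: ifP => // _; apply: fieldC.
  apply/seteqP; split=> x /=.
    move=> h; apply/setP => j; rewrite inE; have := h j; case: ifP => _ hj.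
      by apply/mem_set.
    by apply/negbTE/negP => /set_mem.
  move=> <- j; rewrite inE; case: (boolP (x \in X j)) => [/set_mem //|].
  by move=> /negP h /mem_set.
have muX j : mu (X j) = \sum_(i : {set 'I_n}) (j \in i)%:R * mu (f @^-1` [set i]).
  have -> : X j = [set x | j \in f x].
    apply/seteqP; split=> x /=; rewrite inE; first by move/mem_set.
    by move/set_mem.
  rewrite (fmeasure_preimage hB hmu hf (fun i : {set 'I_n} => j \in i)) big_mkcond.
  by apply: eq_bigr => i _; case: (j \in i); rewrite ?mul1r ?mul0r.
have -> : \sum_(j < n) r j * mu (X j) =
    \sum_(i : {set 'I_n}) (\sum_(j < n) r j * (j \in i)%:R) * mu (f @^-1` [set i]).
  under eq_bigr => j _ do rewrite muX mulr_sumr.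
  rewrite exchange_big; apply: eq_bigr => i _ /=.
  by rewrite mulr_suml; apply: eq_bigr => j _; rewrite mulrA.
rewrite [leLHS](_ : c = \sum_i c * mu (f @^-1` [set i])); last first.
  by rewrite -mulr_sumr (sum_fmeasure_preimage hB hmu hf) mulr1.
apply: ler_sum => i _.
(* An empty atom carries no value of [g], but its measure is 0. *)
have [[x hx]|hn] := pselect (exists x, f x = i); last first.
  rewrite (_ : f @^-1` [set i] = set0) ?(fmeasure0 hB hmu) ?mulr0 //.
  by apply/seteqP; split=> // x /= hx; apply: hn; exists x.
apply: ler_wpM2r; first exact: (fmeasure_ge0 hmu).
rewrite [leRHS](_ : _ = g x) //.
by rewrite hg; apply: eq_bigr => j _; rewrite -hx inE indicE.
Qed.

Lemma simple_integralD g1 v1 g2 v2 : simple_integral B mu g1 v1 ->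
  simple_integral B mu g2 v2 ->
  simple_integral B mu (fun x => g1 x + g2 x) (v1 + v2).
Proof.
move=> [n1 [r1 [X1 [h1 e1 ->]]]] [n2 [r2 [X2 [h2 e2 ->]]]].
exists (n1 + n2)%N, (fun j : 'I_(n1 + n2) => match fintype.split j with inl a => r1 a | inr a => r2 a end).
exists (fun j : 'I_(n1 + n2) => match fintype.split j with inl a => X1 a | inr a => X2 a end).
split.
- by move=> j; case: (fintype.split j).
- move=> x; rewrite e1 e2 big_split_ord /=; congr (_ + _); apply: eq_bigr => j _.
    by rewrite (unsplitK (inl j : 'I_n1 + 'I_n2)).
  by rewrite (unsplitK (inr j : 'I_n1 + 'I_n2)).
- rewrite big_split_ord /=; congr (_ + _); apply: eq_bigr => j _.
    by rewrite (unsplitK (inl j : 'I_n1 + 'I_n2)).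
  by rewrite (unsplitK (inr j : 'I_n1 + 'I_n2)).
Qed.

Lemma simple_integralN g v : simple_integral B mu g v ->
  simple_integral B mu (fun x => - g x) (- v).
Proof.
move=> [n [r [X [h e ->]]]]; exists n, (fun j => - r j), X; split=> // [x|].
  by rewrite e -sumrN; apply: eq_bigr => j _; rewrite mulNr.
by rewrite -sumrN; apply: eq_bigr => j _; rewrite mulNr.
Qed.

(** The lower bound for simple functions is applied to [g] minus a simple function uniformly close
    to [f]. The slack [c] admits a [g] that only approximates [f]. *)
Lemma has_integral_le f l g v (c : K) : has_integral B mu f l ->
  simple_integral B mu g v -> (forall x, f x <= g x + c) -> l <= v + c.
Proof.
move=> [h [w [hs hu hw]]] hg hfg; apply/ler_addgt0Pr => e e0.
have e2 : 0 < e / 2 by rewrite divr_gt0.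
have /cvgrPdist_lt /(_ _ e2) h1 := hw.
have [N [H1 H2]] : exists N, (forall x, `|f x - h N x| < e / 2) /\ `|l - w N| < e / 2.
  near \oo => N; exists N; split; first by near: N; exact: (hu _ e2).
  by near: N.
have H3 : - (c + e / 2) <= v + - w N.
  apply: (simple_integral_ge (simple_integralD hg (simple_integralN (hs N)))) => x.
  have := H1 x; have := hfg x; rewrite ltr_norml => ? /andP[]; lra.
by move: H2; rewrite ltr_norml => /andP[]; lra.
Unshelve. all: by end_near.
Qed.

Lemma has_integral_ge f l g v (c : K) : has_integral B mu f l ->
  simple_integral B mu g v -> (forall x, g x <= f x + c) -> v <= l + c.
Proof.
move=> [h [w [hs hu hw]]] hg hfg; apply/ler_addgt0Pr => e e0.
have e2 : 0 < e / 2 by rewrite divr_gt0.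
have /cvgrPdist_lt /(_ _ e2) h1 := hw.
have [N [H1 H2]] : exists N, (forall x, `|f x - h N x| < e / 2) /\ `|l - w N| < e / 2.
  near \oo => N; exists N; split; first by near: N; exact: (hu _ e2).
  by near: N.
have H3 : - (c + e / 2) <= w N + - v.
  apply: (simple_integral_ge (simple_integralD (hs N) (simple_integralN hg))) => x.
  have := H1 x; have := hfg x; rewrite ltr_norml => ? /andP[]; lra.
by move: H2; rewrite ltr_norml => /andP[]; lra.
Unshelve. all: by end_near.
Qed.

End Integrals.
(** * Finite combinatorics *)

Section SauerShelah.
Import mathcomp.boot.finset.
Local Open Scope nat_scope.
Local Open Scope set_scope.
Variable T : finType.
Implicit Types (F : {set {set T}}) (A J : {set T}).

Definition shattered F J :=
  [forall A : {set T}, (A \subset J) ==> [exists X in F, X :&: J == A]].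

Lemma shatteredP F J :
  reflect (forall A, A \subset J -> exists2 X, X \in F & X :&: J = A)
    (shattered F J).
Proof.
apply: (iffP forallP) => h A.
  by move=> hA; have /implyP /(_ hA) /existsP [X /andP[? /eqP]] := h A; exists X.
by apply/implyP => /h [X hX e]; apply/existsP; exists X; rewrite hX e eqxx.
Qed.

(* Pajor's form of the Sauer-Shelah lemma.  Split F according to an element x that
   separates two of its members: a set J shattered by both halves accounts for
   two sets shattered by F, namely J and x |: J. *)
Lemma card_le_shattered F : #|F| <= #|[set J | shattered F J]|.
Proof.
have [k] := ubnP #|F|; elim: k => // k IH in F *; rewrite ltnS => hk.
have [->|[A hA]] := set_0Vmem F; first by rewrite cards0.
have [F1|F1] := leqP #|F| 1.
  apply: leq_trans F1 _; rewrite card_gt0; apply/set0Pn; exists set0.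
  rewrite inE; apply/shatteredP => X; rewrite subset0 => /eqP ->.
  by exists A; rewrite ?setI0.
have [A' hA' /eqP neA] : exists2 A', A' \in F & A' != A.
  have : 0 < #|F :\ A| by move: F1; rewrite (cardsD1 A) hA.
  by rewrite card_gt0 => /set0Pn [A']; rewrite !inE => /andP[? ?]; exists A'.
have [x hx] : exists x, (x \in A) != (x \in A').
  apply/existsP; apply: contraT => /existsPn h; case: neA; apply/setP => x.
  by have := h x; rewrite negbK => /eqP.
pose F1' := [set X in F | x \in X]; pose F0 := [set X in F | x \notin X].
have cF : #|F| = #|F1'| + #|F0|.
  rewrite -(cardsID [set X : {set T} | x \in X] F); congr (_ + _);
  by apply: eq_card => X; rewrite !inE // andbC.
have [n1 n0] : 0 < #|F1'| /\ 0 < #|F0|.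
  rewrite !card_gt0; case hxA: (x \in A) hx => hx; split; apply/set0Pn;
  [exists A|exists A'|exists A'|exists A]; rewrite inE ?hA ?hA' ?hxA //;
  by move: hx; case: (x \in A').
have IH1 := IH F1' ltac:(lia); have IH0 := IH F0 ltac:(lia).
set S1 := [set J | _] in IH1; set S0 := [set J | _] in IH0.
(* All members of one half agree at [x], so a set shattered by a half cannot contain [x]. *)
have nx1 J : J \in S1 -> x \notin J.
  rewrite inE => /shatteredP h; apply/negP => xJ.
  have [X] := h (J :\ x) (subsetDl _ _); rewrite inE => /andP[_ xX] /setP /(_ x).
  by rewrite !inE xX xJ eqxx.
have nx0 J : J \in S0 -> x \notin J.
  rewrite inE => /shatteredP h; apply/negP => xJ.
  have [X] := h J (subxx _); rewrite inE => /andP[_ xX] /setP /(_ x).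
  by rewrite !inE (negbTE xX) xJ.
rewrite cF; apply: leq_trans (leq_add IH1 IH0) _.
rewrite -cardsUI.
have -> : #|S1 :&: S0| = #|[set x |: J | J in S1 :&: S0]|.
  rewrite card_in_imset // => J J'; rewrite !inE => /andP[h _] /andP[h' _] e.
  have xJ : x \notin J by apply: nx1; rewrite inE.
  have xJ' : x \notin J' by apply: nx1; rewrite inE.
  by rewrite -(setU1K xJ) e setU1K.
have dj : (S1 :|: S0) :&: [set x |: J | J in S1 :&: S0] = set0.
  apply/setP => J; rewrite in_set0 in_setI in_setU; apply/negP => /andP[hJ].
  move=> /imsetP [J' _ eJ]; have : x \notin J by case/orP: hJ; auto.
  by rewrite eJ setU11.
rewrite -cardsUI dj cards0 addn0; apply: subset_leq_card.
apply/fintype.subsetP => J; rewrite in_setU => /orP[|].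
  rewrite in_setU => /orP[]; rewrite !inE => /shatteredP h; apply/shatteredP => X /h [Y];
  by rewrite inE => /andP[? _]; exists Y.
move=> /imsetP [J' hJ' ->]; have /setIP [h1 h0] := hJ'.
rewrite inE; apply/shatteredP => X hX.
have xJ' := nx1 _ h1.
have sX : X :\ x \subset J'.
  apply/fintype.subsetP => y; rewrite !inE => /andP[yx yX].
  by have := fintype.subsetP hX _ yX; rewrite !inE (negbTE yx).
(* Both halves realize the trace [X :\ x] on [J']; the choice of the half decides the membership of
   [x]. *)
case: (boolP (x \in X)) => xX.
  move: h1; rewrite inE => /shatteredP /(_ _ sX) [Y]; rewrite inE => /andP[hY xY] e.
  exists Y => //; rewrite setIUr e.
  by rewrite (setIidPr _) ?sub1set // setD1K.
move: h0; rewrite inE => /shatteredP /(_ _ sX) [Y]; rewrite inE => /andP[hY xY] e.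
exists Y => //; rewrite setIUr e.
have -> : Y :&: [set x] = set0.
  by apply/setP => y; rewrite !inE; case: eqP => [->|]; rewrite ?andbF // (negbTE xY).
by rewrite set0U; apply/setP => y; rewrite !inE; case: eqP => [->|] //; rewrite (negbTE xX).
Qed.

(** A set of at most [d] elements is coded by its enumeration, padded with [None] to length [d]. *)
Lemma card_small_sets d : #|[set J : {set T} | #|J| <= d]| <= #|T|.+1 ^ d.
Proof.
pose f (h : {ffun 'I_d -> option T}) := [set x | [exists i, h i == Some x]].
have : [set J : {set T} | #|J| <= d] \subset f @: [set: {ffun 'I_d -> option T}].
  apply/fintype.subsetP => J; rewrite inE => hJ; apply/imsetP.
  exists [ffun i : 'I_d => onth (enum J) i] => //.
  apply/setP => x; rewrite inE -mem_enum; apply/idP/existsP.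
    move=> hx; have hi : index x (enum J) < d.
      by apply: leq_trans hJ; rewrite cardE index_mem.
    by exists (Ordinal hi); rewrite ffunE /= (onthE _) (nth_map x) ?index_mem // nth_index.
  move=> [i /eqP]; rewrite ffunE => /= h; case: (ltnP i (size (enum J))) => hi.
    by move: h; rewrite onthE (nth_map x) // => -[<-]; rewrite mem_nth.
  by move: h; rewrite onthE nth_default // size_map.
move=> /subset_leq_card h; apply: leq_trans h _.
apply: leq_trans (leq_imset_card _ _) _.
by rewrite cardsT card_ffun card_option card_ord.
Qed.

Lemma sauer_shelah F d : (forall J, shattered F J -> #|J| <= d) ->
  #|F| <= #|T|.+1 ^ d.
Proof.
move=> h; apply: leq_trans (card_le_shattered F) _.
apply: leq_trans (card_small_sets d); apply: subset_leq_card.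
by apply/fintype.subsetP => J; rewrite !inE; apply: h.
Qed.

End SauerShelah.

(** * Random samples and representatives of classes *)

Section Sampling.
Import mathcomp.boot.finset.
Local Open Scope set_scope.
Local Open Scope ring_scope.
Variable K : realFieldType.

(** Average over all samples of size [m]: a far pair agrees on the whole sample with probability at
    most [q ^+ m], and the weights of all pairs sum to 1. Some sample does no worse than the
    average. *)
Lemma exists_separating_sample (I X : finType) (m : nat) (w : X -> K)
    (agree : X -> X -> {set I}) (far : rel X) (q : K) :
  (0 < #|I|)%N -> (forall x, 0 <= w x) -> \sum_x w x = 1 -> 0 <= q ->
  (forall x x', far x x' -> #|agree x x'|%:R <= q * #|I|%:R) ->
  exists s : {ffun 'I_m -> I},
    \sum_x \sum_(x' | far x x' && [forall i, s i \in agree x x']) w x * w x'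
      <= q ^+ m.
Proof.
move=> I0 w0 w1 q0 hfar; apply: contrapT => hn.
have hs (s : {ffun 'I_m -> I}) : q ^+ m <
    \sum_x \sum_(x' | far x x' && [forall i, s i \in agree x x']) w x * w x'.
  by rewrite ltNge; apply/negP => h; apply: hn; exists s.
have I0' : 0 < #|I|%:R :> K by rewrite ltr0n.
have [i0 _] : exists i : I, true by apply/existsP; rewrite -[[exists _, _]]negbK;
  apply/negP => /existsPn h; move: I0; rewrite lt0n => /eqP; apply; apply/eq_card0 => i;
  have := h i.
have : \sum_(s : {ffun 'I_m -> I}) q ^+ m < \sum_(s : {ffun 'I_m -> I})
    \sum_x \sum_(x' | far x x' && [forall i, s i \in agree x x']) w x * w x'.
  (* A strict inequality between the sums requires at least one sample; the constant one is singled
     out. *)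
  rewrite (bigD1 [ffun => i0]) //= [ltRHS](bigD1 [ffun => i0]) //=.
  by apply: ltr_leD => //; apply: ler_sum => s _; apply: ltW.
rewrite ltNge => /negP; apply.
rewrite sumr_const card_ffun card_ord exchange_big /=.
have -> : q ^+ m *+ (#|I| ^ m) =
    \sum_x \sum_x' w x * w x' * (q * #|I|%:R) ^+ m.
  under eq_bigr => x _.
    rewrite -mulr_suml -mulr_sumr w1 mulr1; over.
  by rewrite -mulr_suml w1 mul1r exprMn -natrX mulr_natr.
apply: ler_sum => x _.
under eq_bigr => s _ do rewrite big_mkcond.
rewrite exchange_big /=; apply: ler_sum => x' _.
rewrite -big_mkcond.
have W0 : 0 <= w x * w x' by rewrite mulr_ge0.
(* The samples that fail to separate a pair are the functions into its agreement set, so their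
   number is an [m]-th power. *)
rewrite (eq_bigl (fun s : {ffun 'I_m -> I} =>
    far x x' && (s \in ffun_on (mem (agree x x'))))); last first.
  by move=> s; congr andb; apply/forallP/ffun_onP.
case hf: (far x x'); last first.
  by rewrite big_pred0 // mulr_ge0 // exprn_ge0 // mulr_ge0 // ler0n.
rewrite sumr_const -[leLHS]mulr_natr; apply: ler_wpM2l => //.
rewrite card_ffun_on card_ord.
by rewrite natrX; apply: lerXn2r; rewrite ?nnegrE ?ler0n ?mulr_ge0 ?ler0n //; apply: hfar.
Qed.

(* With bad c the weight of the points of the class c far from its representative
   and Q c the weight of the far pairs in c, averaging over the representative
   gives (bad c)^2 <= Q c, and bad c <= (lam + (bad c)^2 / lam) / 2 by AM-GM. *)
Lemma exists_representatives (X F : finType) (w : X -> K) (cls : X -> F)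
    (far : rel X) (real : pred X) (lam : K) :
  (forall x, 0 <= w x) -> \sum_x w x = 1 -> (forall x, ~~ real x -> w x = 0) ->
  0 < lam ->
  exists rep : F -> X,
    (forall x, real x -> real (rep (cls x)) /\ cls (rep (cls x)) = cls x) /\
    \sum_(x | far x (rep (cls x))) w x <=
      (lam * #|[set cls x | x in real]|%:R +
      (\sum_x \sum_(x' | far x x' && (cls x == cls x')) w x * w x') / lam) / 2.
Proof.
move=> w0 w1 wreal lam0.
have [x0 _] : exists x : X, true.
  apply/existsP; rewrite -[[exists _, _]]negbK; apply/negP => /existsPn h.
  by move: w1; rewrite big_pred0 => [/eqP|x]; [rewrite eq_sym oner_eq0|have := h x].
pose bad c r := \sum_(x | (cls x == c) && far x r) w x.
pose Q c := \sum_(x' | cls x' == c) w x' * bad c x'.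
have bad0 c r : 0 <= bad c r by apply: sumr_ge0.
have Q0 c : 0 <= Q c by apply: sumr_ge0 => x _; apply: mulr_ge0.
pose img := [set cls x | x in real].
have H c : exists r, (c \in img -> real r /\ cls r = c) /\
    bad c r <= (lam * (c \in img)%:R + Q c / lam) / 2.
  case: (boolP (c \in img)) => hc; last first.
    exists x0; split=> //; rewrite mulr0 add0r /bad big1.
      by rewrite !divr_ge0 // ltW.
    move=> x /andP[/eqP hx _]; apply: wreal; apply: contra hc => hx'.
    by rewrite -hx; apply: imset_f.
  have /imsetP [x1 hx1 ec] := hc.
  have P1 : real x1 && (cls x1 == c) by rewrite ec eqxx andbT; exact: hx1.
  (* The minimum is taken over real points only, since the representative must later come from a
     point of W. The other points have weight 0, so the minimum still lies below the average. *)
  case: (@Order.TotalTheory.arg_minP _ _ _ x1 (fun x => real x && (cls x == c)) (bad c) P1).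
  move=> r /andP[hr /eqP hrc] hmin; exists r; split=> // ; rewrite mulr1.
  have h1 : (\sum_(x | cls x == c) w x) * bad c r <= Q c.
    rewrite mulr_suml; apply: ler_sum => x hx.
    case: (boolP (real x)) => hrx; last by rewrite (wreal _ hrx) !mul0r.
    by apply: ler_wpM2l => //; apply: hmin; rewrite hrx.
  have h2 : bad c r <= \sum_(x | cls x == c) w x.
    rewrite /bad big_mkcondr; apply: ler_sum => x _; by case: ifP.
  have h3 : bad c r * bad c r <= Q c.
    by apply: le_trans h1; apply: ler_wpM2r.
  rewrite ler_pdivlMr // -(ler_pM2r lam0) mulrDl divfK ?gt_eqF //.
  have := sqr_ge0 (bad c r - lam); rewrite expr2; nra.
have [rep hrep] := choice H.
exists rep; split.
  by move=> x hx; have [h _] := hrep (cls x); apply: h; apply: imset_f.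
rewrite (partition_big cls predT) //=.
apply: (@le_trans _ _ (\sum_c (lam * (c \in img)%:R + Q c / lam) / 2)).
  apply: ler_sum => c _; apply: le_trans (proj2 (hrep c)).
  rewrite le_eqVlt; apply/orP; left; apply/eqP; apply: eq_bigl => x.
  by rewrite andbC; case: eqP => [->|].
rewrite -mulr_suml; apply: ler_wpM2r; first by rewrite invr_ge0 ler0n.
rewrite big_split /=; apply: lerD.
  rewrite -mulr_sumr ler_pM2l // -natr_sum ler_nat -sum1_card [leqRHS]big_mkcond /=.
  by apply: leq_sum => c _; case: (c \in img).
rewrite -mulr_suml ler_pM2r ?invr_gt0 //.
rewrite [leRHS](exchange_big_dep xpredT) //= [leRHS](partition_big cls xpredT) //=.
apply: ler_sum => c _; apply: ler_sum => x' /eqP hx'.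
rewrite mulr_sumr le_eqVlt; apply/orP; left; apply/eqP.
under eq_bigr => x _ do rewrite mulrC.
by apply: eq_bigl => x; rewrite hx' andbC.
Qed.

End Sampling.
(** * Partitions by traces on a sample *)

Section BinaryPartition.
Import mathcomp.boot.finset.
Local Open Scope set_scope.
Local Open Scope ring_scope.
Variables (K : realType) (V W : Type) (S : set (V * W)).

(** The trace of the fibre at [y] on the sample, recorded by indices so that sample points may
    repeat. *)
Definition pattern m (P : 'I_m -> V) (y : W) : {set 'I_m} :=
  [set i | (P i, y) \in S].

Definition realized m (P : 'I_m -> V) : pred {set 'I_m} :=
  fun c => `[< exists y, pattern P y = c >].

Lemma realized_pattern m (P : 'I_m -> V) y : realized P (pattern P y).
Proof. by apply/asboolP; exists y. Qed.

(** Realizing every [J] forces [q] to be injective, so this is the VC bound on the fibres of [S],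
    stated with indices. *)
Definition no_shattering d := ~ exists q : 'I_d.+1 -> V,
  forall J : {set 'I_d.+1}, exists y, pattern q y = J.

(** Sauer-Shelah on the index set: from a shattered set of more than [d] indices, [d.+1] sample
    points shattered by the fibres can be selected. *)
Lemma card_realized d m (P : 'I_m -> V) : no_shattering d ->
  (#|[set c | realized P c]| <= m.+1 ^ d)%N.
Proof.
move=> hd; rewrite -[X in (X.+1 ^ d)%N](card_ord m); apply: sauer_shelah => J hJ.
rewrite leqNgt; apply/negP => dJ; apply: hd.
pose g (i : 'I_d.+1) : 'I_m := enum_val (widen_ord dJ i).
have gJ i : g i \in J by apply: enum_valP.
have ginj : injective g.
  by move=> i i' /enum_val_inj /(congr1 val) /= h; apply: val_inj.
exists (P \o g) => J'.
have /shatteredP /(_ (g @: J')) := hJ.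
have sub : g @: J' \subset J.
  by apply/fintype.subsetP => _ /imsetP [i _ ->].
move=> /(_ sub) [X]; rewrite inE => /asboolP [y hy] e.
exists y; apply/setP => i; rewrite inE -[RHS](mem_imset _ _ ginj) -e inE gJ andbT.
by rewrite -hy inE.
Qed.

(** A class is an intersection of sections at the sample points or their complements, so the sample
    provides all its parameters. *)
Lemma pattern_definable m (P : 'I_m -> V) c :
  gen_field (range (fun i => xsection S (P i)))%classic
    (pattern P @^-1` [set c])%classic.
Proof.
set G := range _; have hG := gen_field_is_field G.
have := @field_bigcap _ _ hG 'I_m (fun i =>
  if i \in c then xsection S (P i) else ~` xsection S (P i))%classic.
rewrite (_ : [set x | _]%classic = (pattern P @^-1` [set c])%classic).
  apply=> i; have h : gen_field G (xsection S (P i)).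
    by apply: sub_gen_field; exists i.
  by case: ifP => // _; apply: (fieldC hG).
apply/seteqP; split=> y /=.
  move=> h; apply/setP => i; rewrite inE; have := h i; case: ifP => _ hi.
    by move/xsectionP: hi => hi; apply/mem_set.
  by apply/negbTE/negP => /set_mem hy; apply: hi; apply/xsectionP.
move=> <- i; rewrite inE; case: (boolP (_ \in S)) => [/set_mem h|h].
  exact/xsectionP.
by move=> /xsectionP h'; move/negP: h; apply; apply/mem_set.
Qed.

Variables (BW : set (set W)) (mu : set V -> K) (nu : set W -> K).
Hypotheses (hBW : is_field BW) (hnu : is_measure BW nu).
Hypothesis hxS : forall v, BW (xsection S v).

Lemma pattern_field m (P : 'I_m -> V) c : BW (pattern P @^-1` [set c])%classic.
Proof.
have h := @pattern_definable m P c; apply: (gen_field_min hBW _ h).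
by move=> _ [i _ <-].
Qed.

Lemma pattern_section m (P : 'I_m -> V) : exists rep : {set 'I_m} -> W,
  forall c, realized P c -> pattern P (rep c) = c.
Proof.
have [y0 _] := fmeasure_nonempty hBW hnu.
have H (c : {set 'I_m}) : exists y, realized P c -> pattern P y = c.
  case: (boolP (realized P c)) => [/asboolP [y hy]|_]; first by exists y.
  by exists y0.
by have [rep hrep] := choice H; exists rep.
Qed.

Let dist y y' := mu (ysection S y `+` ysection S y')%classic.

(** [pi] sends a point to its class, [b] picks representatives and [T] is the exceptional set. In
    the induction [m] counts the parameters on the new factor, and [N] the fibres to be approximated
    in turn. *)
Definition approx_partition (eps : K) (m N : nat) :=
  exists (P : 'I_m -> V) (F : finType) (pi : W -> F) (b : F -> W) (T : set W),
  [/\ (#|F| <= N)%N,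
      forall c, gen_field (range (fun i => xsection S (P i)))%classic
        (pi @^-1` [set c])%classic,
      BW T, nu T <= eps
    & forall y, ~ T y -> dist y (b (pi y)) <= eps].

(** Classes are indexed by the realized patterns only, so that their number obeys the Sauer-Shelah
    bound rather than [2 ^ m]. *)
Lemma approx_partitionI (eps : K) m N (P : 'I_m -> V) (rep : {set 'I_m} -> W)
    (T : set W) : (#|[set c | realized P c]| <= N)%N ->
  BW T -> nu T <= eps -> (forall y, ~ T y -> dist y (rep (pattern P y)) <= eps) ->
  approx_partition eps m N.
Proof.
move=> hN hT nT hrep.
exists P, {c : {set 'I_m} | realized P c}.
exists (fun y => Sub (pattern P y) (realized_pattern P y)), (fun c => rep (val c)), T.
split=> //.
  by rewrite card_sig; apply: leq_trans hN; rewrite cardsE.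
move=> c; rewrite (_ : (_ @^-1` _)%classic = (pattern P @^-1` [set (val c)])%classic).
  exact: pattern_definable.
by apply/seteqP; split=> y /= h; [rewrite -h|apply: val_inj].
Qed.

Definition finitely_approx_dist := forall e : K, 0 < e ->
  exists n : nat, (0 < n)%N /\ exists p : 'I_n -> V, forall y y',
  `|dist y y' - n%:R^-1 *
    #|[pred j | p j \in (ysection S y `+` ysection S y')%classic]|%:R| < e.

Let symd n (f f' : {set 'I_n}) := [set i | (i \in f) (+) (i \in f')].

Lemma card_pattern_symd n (p : 'I_n -> V) y y' :
  #|[pred j | p j \in (ysection S y `+` ysection S y')%classic]| =
  #|symd (pattern p y) (pattern p y')|.
Proof.
apply: eq_card => i; rewrite !inE.
have e z : (p i \in ysection S z) = ((p i, z) \in S) by rewrite mem_ysection.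
rewrite -!e classical_sets.in_setU !classical_sets.in_setD.
by case: (_ \in _); case: (_ \in _).
Qed.

(** Without a VC bound the whole approximating family serves as the sample: fibres with equal traces
    have empirical distance 0, and no exceptional set arises. *)
Lemma exists_approx_partition : finitely_approx_dist -> forall eps, 0 < eps ->
  exists m N, approx_partition eps m N.
Proof.
move=> hfap eps e0; have [n [n0 [p hp]]] := hfap _ e0.
have [rep hrep] := pattern_section p.
exists n, #|[set c | realized p c]|; apply: (@approx_partitionI _ _ _ p rep classical_sets.set0) => //.
- exact: (field0 hBW).
- by rewrite (fmeasure0 hBW hnu) ltW.
- move=> y _; have := hp y (rep (pattern p y)).
  rewrite card_pattern_symd (hrep _ (realized_pattern _ _)).
  rewrite (_ : symd _ _ = set0) ?cards0 ?mulr0 ?subr0.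
    by rewrite ltr_norml => /andP[_ /ltW].
  by apply/setP => i; rewrite !inE addbb.
Qed.

(** The sampling lemmas are applied to the patterns on an approximating family [p], weighted by
    [nu]; the [m] sample points are drawn from [p]. Far means empirical distance at least eps/2. *)
Lemma exists_approx_partition_vc d : no_shattering d -> finitely_approx_dist ->
  forall eps m, 0 < eps -> eps <= 1 ->
  (1 - eps / 2) ^+ m * m.+1%:R ^+ d <= eps ^+ 2 ->
  approx_partition eps m (m.+1 ^ d).
Proof.
move=> hd hfap eps m e0 e1 hm.
have e20 : 0 < eps / 2 by rewrite divr_gt0.
have [n [n0 [p hp]]] := hfap _ e20.
pose w (f : {set 'I_n}) := nu (pattern p @^-1` [set f])%classic.
pose agree (f f' : {set 'I_n}) := ~: symd f f'.
pose far (f f' : {set 'I_n}) := eps / 2 * n%:R <= #|symd f f'|%:R.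
have w0 f : 0 <= w f by apply: (fmeasure_ge0 hnu); apply: pattern_field.
have w1 : \sum_f w f = 1.
  by apply: (sum_fmeasure_preimage hBW hnu); apply: pattern_field.
have wr f : ~~ realized p f -> w f = 0.
  move=> /asboolP h; rewrite /w (_ : (_ @^-1` _)%classic = classical_sets.set0).
    exact: (fmeasure0 hBW hnu).
  by apply/seteqP; split=> // y hy; apply: h; exists y.
have q0 : 0 <= 1 - eps / 2 by lra.
have n0' : (0 < #|'I_n|)%N by rewrite card_ord.
have hfar f f' : far f f' -> #|agree f f'|%:R <= (1 - eps / 2) * #|'I_n|%:R.
  rewrite /far card_ord => h.
  have := cardsC (symd f f'); rewrite card_ord => hc.
  have := congr1 (fun k => k%:R : K) hc; rewrite natrD.
  by move=> hn; rewrite mulrBl mul1r; lra.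
have [s hs] := exists_separating_sample m n0' w0 w1 q0 hfar.
pose cls (f : {set 'I_n}) : {set 'I_m} := [set i | s i \in f].
have clsE y : pattern (p \o s) y = cls (pattern p y).
  by apply/setP => i; rewrite !inE.
pose M : K := m.+1%:R ^+ d.
have M0 : 0 < M by rewrite exprn_gt0.
(* With [lam = eps / M] both terms of the bound on the bad weight are at most [eps]: the first
   because there are at most [M] classes, the second by [hm]. *)
have lam0 : 0 < eps / M by rewrite divr_gt0.
have [rep [hrep hsum]] := exists_representatives cls far w0 w1 wr lam0.
have [yrep hyrep] := pattern_section p.
pose bad f := far f (rep (cls f)).
apply: (@approx_partitionI _ _ _ (p \o s) (fun c => yrep (rep c))
  [set y | bad (pattern p y)]%classic).
- exact: card_realized.
- by apply: (@field_preimage_fin _ _ hBW _ (pattern p)); apply: pattern_field.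
- rewrite (fmeasure_preimage hBW hnu (f := pattern p) (pattern_field p) bad).
  apply: le_trans hsum _.
  have h1 : eps / M * #|[set cls x | x in realized p]|%:R <= eps.
    rewrite -mulrA ger_pMr // mulrC ler_pdivrMr // mul1r /M -natrX ler_nat.
    apply: leq_trans (card_realized (p \o s) hd); apply: subset_leq_card.
    apply/fintype.subsetP => _ /imsetP [f /asboolP [y hy] ->].
    by rewrite inE -hy -clsE realized_pattern.
  have h2 : (\sum_x \sum_(x' | far x x' && (cls x == cls x')) w x * w x') / (eps / M) <= eps.
    rewrite ler_pdivrMr // mulrA -expr2 ler_pdivlMr //.
    apply: le_trans hm; rewrite ler_pM2r //; apply: le_trans hs.
    (* Far pairs within one class agree on the whole sample, hence are among the pairs that [s] does
       not separate. *)
    apply: ler_sum => x _; rewrite [leLHS]big_mkcond [leRHS]big_mkcond /=.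
    apply: ler_sum => x' _; case: (far x x') => //=.
    case: eqP => [hx|_]; last by case: ifP => // _; rewrite mulr_ge0.
    rewrite ifT //; apply/forallP => i; rewrite !inE.
    by move/setP: hx => /(_ i); rewrite !inE => ->; rewrite addbb.
  by rewrite ler_pdivrMr //; lra.
(* Outside the bad set the empirical distance is below eps/2, and replacing it by the true distance
   costs another eps/2. *)
- move=> y /= /negP; rewrite /bad /far -ltNge clsE => hb.
  have := hp y (yrep (rep (cls (pattern p y)))).
  have [hr _] := hrep _ (realized_pattern p y).
  rewrite card_pattern_symd (hyrep _ hr).
  rewrite ltr_norml => /andP[_ h].
  have : n%:R^-1 * #|symd (pattern p y) (rep (cls (pattern p y)))|%:R < eps / 2.
    by rewrite mulrC ltr_pdivrMr ?ltr0n.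
  lra.
Qed.

End BinaryPartition.

(** * The size of the sample *)

Lemma le_bernoulli (K : realFieldType) (x : K) q : 0 <= x -> q%:R * x <= (1 + x) ^+ q.
Proof.
move=> x0; suff : 1 + q%:R * x <= (1 + x) ^+ q by apply: le_trans; rewrite lerDr.
elim: q => [|q IH]; first by rewrite mul0r addr0 expr0.
rewrite exprS; apply: le_trans (ler_wpM2l _ IH); last by rewrite addr_ge0.
rewrite -natr1 mulrDl mul1r mulrDr mulr1 mulrDl mul1r.
have : 0 <= x * (q%:R * x) by rewrite !mulr_ge0.
lra.
Qed.

(* m is of order eps^-2: then (1 - eps/2)^m is O(eps^(2d+2)), whereas (m+1)^d is
   O(eps^(-2d)); the choice of c makes the product of the constants at most 1. *)
Lemma exists_sample_size (K : realType) (d : nat) :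
  exists2 C : K, 1 <= C & forall eps : K, 0 < eps -> eps <= 1 -> exists m : nat,
  [/\ m%:R <= C * eps^-1 ^+ 2, m.+1%:R ^+ d <= C * eps^-1 ^+ (2 * d)
    & (1 - eps / 2) ^+ m * m.+1%:R ^+ d <= eps ^+ 2].
Proof.
(* [A] is large enough for [m + 1 <= A * s], and [c] is such that [A * (2 / c) ^+ 2] is exactly
   1. *)
pose r : K := (2 * d.+1)%:R; pose c := 12 * r; pose A := 3 * r * c.
have r2 : 2 <= r by rewrite ler_nat mulnS leq_addr.
have c1 : 24 <= c by rewrite /c; lra.
have A1 : 1 <= A.
  by rewrite /A; apply: (@le_trans _ _ (3 * 2 * 24)); [lra|rewrite ler_pM //; lra].
have hA : r * (c + 1) + 1 <= A by rewrite /A; nra.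
exists (A ^+ d.+1); first by rewrite exprn_ege1.
move=> eps e0 e1; pose t := eps^-1; pose s := t ^+ 2.
have t1 : 1 <= t by rewrite /t invf_ge1.
have s1 : 1 <= s by rewrite exprn_ege1.
have As0 : 0 <= A * s by rewrite mulr_ge0; lra.
have et : eps * t = 1 by rewrite mulfV // gt_eqF.
pose q := (Num.truncn (c * s)).+1.
have cs0 : 0 <= c * s by rewrite mulr_ge0; lra.
have q1 : c * s <= q%:R by apply/ltW/truncnS_gt.
have q2 : q%:R <= (c + 1) * s.
  have : (Num.truncn (c * s))%:R <= c * s by rewrite truncn_le.
  rewrite /q -natr1 mulrDl mul1r => h; exact: lerD.
pose m := (q * (2 * d.+1))%N.
have mS : m.+1%:R <= A * s.
  rewrite -natr1 /m natrM -/r.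
  have : q%:R * r <= (c + 1) * s * r by rewrite ler_wpM2r //; lra.
  have : (r * (c + 1) + 1) * s <= A * s by rewrite ler_wpM2r //; lra.
  lra.
exists m; split.
- apply: (@le_trans _ _ m.+1%:R); first by rewrite ler_nat.
  apply: (le_trans mS); rewrite ler_wpM2r //; first lra.
  by rewrite exprS ler_peMr ?exprn_ege1 //; lra.
- rewrite exprM -/t -/s.
  apply: (@le_trans _ _ ((A * s) ^+ d)).
    by rewrite lerXn2r // nnegrE ler0n.
  rewrite exprMn ler_wpM2r ?exprn_ge0 //; first lra.
  by rewrite exprS ler_peMl ?exprn_ge0 //; lra.
pose x := eps / 2; rewrite -/x.
have [x0 x1] : 0 <= x /\ x <= 1 by rewrite /x; lra.
have x1' : 0 <= 1 - x by lra.
pose u := (1 - x) ^+ q.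
have u0 : 0 <= u by rewrite exprn_ge0 //; lra.
(* Since [(1 - x) * (1 + x) <= 1], Bernoulli's lower bound on [(1 + x) ^+ q] bounds [u] from above
   by [2 * eps / c]. *)
have hu : u * (c * t / 2) <= 1.
  apply: (@le_trans _ _ (u * (1 + x) ^+ q)).
    rewrite ler_wpM2l //; apply: le_trans (le_bernoulli q x0).
    have : c * s * x <= q%:R * x by rewrite ler_wpM2r.
    apply: le_trans; rewrite /x /s expr2 le_eqVlt; apply/orP; left; apply/eqP.
    by rewrite -[in LHS](mulr1 t) -et; ring.
  rewrite -exprMn exprn_ile1 //; first by rewrite mulr_ge0; lra.
  nra.
have ut : u * t <= 2 / c.
  rewrite ler_pdivlMr; last lra.
  by move: hu; rewrite mulrA ler_pdivrMr // mul1r; congr (_ <= _); ring.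
have ut0 : 0 <= u * t by rewrite mulr_ge0 //; lra.
have c0 : 0 < c by lra.
have ut2 : u ^+ 2 * s <= (2 / c) ^+ 2.
  by rewrite -exprMn lerXn2r // nnegrE // divr_ge0 // ltW.
have H1 : u ^+ 2 <= eps ^+ 2.
  have -> : u = u * t * eps by rewrite -mulrA [t * _]mulrC et mulr1.
  rewrite exprMn ler_piMl ?exprn_ge0 ?(ltW e0) // exprn_ile1 //.
  by apply: (le_trans ut); rewrite ler_pdivrMr // mul1r; lra.
have H2 : u ^+ 2 * (A * s) <= 1.
  rewrite mulrCA; apply: (@le_trans _ _ (A * (2 / c) ^+ 2)).
    by rewrite ler_wpM2l //; lra.
  rewrite le_eqVlt; apply/orP; left; apply/eqP; rewrite /A {1}/c.
  by rewrite /c; field; rewrite gt_eqF //; lra.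
rewrite /m exprM -/u exprM.
apply: (@le_trans _ _ (u ^+ 2 ^+ d.+1 * (A * s) ^+ d)).
  by rewrite ler_wpM2l ?exprn_ge0 // lerXn2r // nnegrE ler0n.
(* The product is [u ^+ 2] times the [d]-th power of [u ^+ 2 * (A * s)], and [H2] bounds the latter
   by 1. *)
rewrite exprS -mulrA -exprMn; apply: le_trans H1.
rewrite ler_piMr ?exprn_ge0 // exprn_ile1 //.
by rewrite mulr_ge0 ?exprn_ge0.
Qed.
(** * The product of two measures *)

(** Any finite index type is allowed for the points, in particular a grid. *)
Lemma fap_onI (K : realType) (V : Type) (mu : set V -> K) (F : set (set V)) :
  (forall eps : K, 0 < eps -> exists (I : finType) (p : I -> V), (0 < #|I|)%N /\
    forall A, F A -> `|mu A - #|I|%:R^-1 * \sum_i (p i \in A)%:R| < eps) ->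
  fap_on mu F.
Proof.
move=> h eps /h [I [p [I0 hp]]]; exists #|I|; split=> //.
exists (fun j => p (enum_val j)) => A /hp; congr (`|_ - _ * _| < _).
rewrite -sum1_card natr_sum big_mkcond /= [RHS]big_mkcond /=.
rewrite (reindex _ (onW_bij _ (@enum_val_bij I))) /=.
by apply: eq_bigr => i _; rewrite inE; case: (_ \in _).
Qed.

Section BinaryProduct.
Variables (K : realType) (V W Z : Type) (R : set (V * W * Z)).
Variables (BV : set (set V)) (mu : set V -> K) (BW : set (set W)) (nu : set W -> K).
Variable (m : set (V * W) -> K).
Hypotheses (hBV : is_field BV) (hmu : is_measure BV mu).
Hypotheses (hBW : is_field BW) (hnu : is_measure BW nu).
Hypothesis hm : is_lprod R BV mu BW nu m.

Let hF : is_field (lprod_field R BV BW) := @gen_field_is_field _ _.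
Let hmm : is_measure (lprod_field R BV BW) m. Proof. by case: hm. Qed.

Lemma lprod_field_box A B : BV A -> BW B -> lprod_field R BV BW (A `*` B).
Proof.
move=> hA hB; apply: sub_gen_field; left; apply: sub_gen_field.
by exists A, B.
Qed.

Lemma lprod_field_ysection c : lprod_field R BV BW (ysection R c).
Proof. by apply: sub_gen_field; right; exists c. Qed.

Lemma lprod_le_integral E A B (e : K) : definable R setT E -> BV A -> BW B ->
  0 <= e -> (forall y, B y -> mu (A `&` ysection E y) <= e) ->
  m (E `&` (A `*` B)) <= e * nu B.
Proof.
move=> hE hA hB e0 he; case: hm => _ _ /(_ _ _ _ hE hA hB) hint.
have hs : simple_integral BW nu (fun y => e * \1_B y) (e * nu B).
  exists 1%N, (fun=> e), (fun=> B); split=> // [x|]; by rewrite big_ord1.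
rewrite -[leRHS]addr0; apply: (has_integral_le hBW hnu hint hs) => y.
rewrite addr0 indicE; case: (boolP (y \in B)) => [/set_mem hy|_].
  by rewrite mul1r mulr1; apply: he.
by rewrite mul0r mulr0.
Qed.

Section Approximation.
Variables (z : Z) (F : finType) (pi : W -> F) (b : F -> W) (T : set W).
Variables (A : F -> set V) (e : K).
Let S := ysection R z.
Hypotheses (e0 : 0 <= e) (hS : forall y, BV (ysection S y)).
Hypotheses (hpi : forall c, BW (pi @^-1` [set c])) (hT : BW T) (nT : nu T <= e).
Hypothesis hb : forall y, ~ T y -> mu (ysection S y `+` ysection S (b (pi y))) <= e.
Hypotheses (hA : forall c, BV (A c)).
Hypothesis hbA : forall c, mu (ysection S (b c) `+` A c) <= e.

(** The difference is covered by the strip [P0] over [T] and, in each class, by [P1] and [P2], where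
    [S] differs from the fibre at the representative, and [P3], where that fibre differs from [A c].
    Each kind contributes at most [e] in total. *)
Lemma lprod_approx_le : m (S `+` [set x | A (pi x.2) x.1]) <= 4 * e.
Proof.
have dS : definable R setT S by apply: sub_gen_field; exists z.
have dSC : definable R setT (~` S) by apply: (fieldC (gen_field_is_field _)).
(* Off [T] the bound [hb] holds pointwise, so the integral formula bounds [P1] and [P2]; [P0] and
   [P3] are boxes. *)
pose W' c := (pi @^-1` [set c]) `\` T.
have hW' c : BW (W' c) by apply: (fieldD hBW).
pose P1 c := S `&` ((~` ysection S (b c)) `*` W' c).
pose P2 c := (~` S) `&` (ysection S (b c) `*` W' c).
pose P3 c := (ysection S (b c) `+` A c) `*` (pi @^-1` [set c]).
pose P0 := (setT : set V) `*` T.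
have hSC c : BV (~` ysection S c) by apply: (fieldC hBV).
have hY c c' : BV (ysection S c `+` ysection S c') by apply: (fieldY hBV).
have hYA c c' : BV (ysection S c `+` A c') by apply: (fieldY hBV).
have lS : lprod_field R BV BW S by apply: lprod_field_ysection.
have l0 : lprod_field R BV BW P0 by apply: lprod_field_box => //; apply: (fieldT hBV).
have l1 c : lprod_field R BV BW (P1 c).
  by apply: (fieldI hF) => //; apply: lprod_field_box.
have l2 c : lprod_field R BV BW (P2 c).
  by apply: (fieldI hF); [apply: (fieldC hF)|apply: lprod_field_box].
have l3 c : lprod_field R BV BW (P3 c) by apply: lprod_field_box.
pose Q c := (P1 c `|` P2 c) `|` P3 c.
have lQ c : lprod_field R BV BW (Q c) by apply: (fieldU hF) => //; apply: (fieldU hF).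
have lQQ : lprod_field R BV BW [set x | exists c, Q c x].
  have := field_bigcup hF predT lQ; congr (lprod_field _ _ _ _).
  by apply/seteqP; split=> x [c]; exists c.
have lA : lprod_field R BV BW [set x | A (pi x.2) x.1].
  have := field_bigcup hF predT (F := fun c => A c `*` (pi @^-1` [set c])).
  move=> /(_ (fun c => lprod_field_box (hA c) (hpi c))).
  congr (lprod_field _ _ _ _); apply/seteqP; split=> x /=.
    by move=> [c _ [? ->]].
  by move=> ?; exists (pi x.2).
have sub : S `+` [set x | A (pi x.2) x.1] `<=` P0 `|` [set x | exists c, Q c x].
  move=> [x y] hxy; have [yT|yT] := pselect (T y); first by left.
  right; exists (pi y).
  have [hbx|hbx] := pselect (S (x, b (pi y))).
    case: hxy => /= -[h1 h2].
      by right; split=> //; left; split=> //; apply/ysectionP.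
    by left; right; split=> //; split=> //; apply/ysectionP.
  case: hxy => /= -[h1 h2].
    by left; left; split=> //; split=> // /ysectionP.
  by right; split=> //; right; split=> // /ysectionP.
apply: (le_trans (fmeasure_le hF hmm _ _ sub)); first exact: (fieldY hF).
  exact: (fieldU hF).
apply: (le_trans (fmeasure_leU hF hmm l0 lQQ)).
have n0 : m P0 <= e.
  case: hm => _ hbox _; rewrite hbox //; last exact: (fieldT hBV).
  by rewrite (measureT hmu) mul1r.
have nW c : nu (W' c) <= nu (pi @^-1` [set c]).
  by apply: (fmeasure_le hBW hnu) => // x [].
have n1 c : m (P1 c) <= e * nu (pi @^-1` [set c]).
  apply: (@le_trans _ _ (e * nu (W' c))); last by rewrite ler_wpM2l.
  apply: lprod_le_integral => // y [/= hy yT].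
  apply: le_trans (hb yT); apply: (fmeasure_le hBV hmu) => //.
    exact: (fieldI hBV).
  by rewrite hy => x [h1 h2]; left.
have n2 c : m (P2 c) <= e * nu (pi @^-1` [set c]).
  apply: (@le_trans _ _ (e * nu (W' c))); last by rewrite ler_wpM2l.
  have yC y : ysection (~` S) y = ~` ysection S y.
    by rewrite !ysectionE preimage_setC.
  apply: lprod_le_integral => // y [/= hy yT].
  rewrite yC; apply: le_trans (hb yT); apply: (fmeasure_le hBV hmu) => //.
    exact: (fieldI hBV).
  by rewrite hy => x [h1 h2]; right.
have n3 c : m (P3 c) <= e * nu (pi @^-1` [set c]).
  case: hm => _ hbox _; rewrite hbox // ler_wpM2r //.
  exact: (fmeasure_ge0 hnu).
have nQ c : m (Q c) <= 3 * e * nu (pi @^-1` [set c]).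
  have h1 := fmeasure_leU hF hmm (fieldU hF (l1 c) (l2 c)) (l3 c).
  have h2 := fmeasure_leU hF hmm (l1 c) (l2 c).
  by have := n1 c; have := n2 c; have := n3 c; rewrite /Q; lra.
have nQQ : m [set x | exists c, Q c x] <= 3 * e.
  apply: (le_trans (fmeasure_bigcup_le hF hmm lQ)).
  apply: (@le_trans _ _ (\sum_c 3 * e * nu (pi @^-1` [set c]))).
    by apply: ler_sum.
  by rewrite -mulr_sumr (sum_fmeasure_preimage hBW hnu) // mulr1.
lra.
Qed.

End Approximation.

Section Fap.
Variables (Z1 Z2 : Type) (R1 : set (V * Z1)) (R2 : set (W * Z2)).
Variables (phi : W -> Z -> Z1) (psi : V -> Z -> Z2).
Hypothesis hphi : forall y c, ysection (ysection R c) y = ysection R1 (phi y c).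
Hypothesis hpsi : forall x c, xsection (ysection R c) x = ysection R2 (psi x c).
Hypothesis hR2 : forall c, BW (ysection R2 c).

(** The product of the two point families works. A combination of [M] fibres has sections that are
    combinations of at most [M] fibres of [R1] or [R2]: [p] replaces [mu] uniformly under the
    integral, then [q] replaces [nu] on each section at a point of [p]. *)
Lemma fap_lprod : fap R1 mu -> fap R2 nu -> fap R m.
Proof.
move=> f1 f2 M; apply: fap_onI => eps eps0.
(* The errors add up to at most 3 eps/4, so the final inequality is strict. *)
have e2 : 0 < eps / 2 by rewrite divr_gt0.
have e4 : 0 < eps / 4 by rewrite divr_gt0.
have [n [n0 [p hp]]] := f1 M _ e2; have [n' [n'0 [q hq]]] := f2 M _ e4.
exists ('I_n * 'I_n')%type, (fun i => (p i.1, q i.2)).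
rewrite card_prod !card_ord muln_gt0 n0 n'0; split=> // E [D [hD hE]].
have cD T (f : Z -> T) : (f @` D #<= `I_M)%card.
  by apply: card_le_trans hD; apply: card_image_le.
have hEy y : definable R1 (phi y @` D) (ysection E y).
  rewrite ysectionE; apply: gen_field_preimage hE; first exact: gen_field_is_field.
  move=> _ [c hc <-]; apply: sub_gen_field; exists (phi y c); first by exists c.
  by rewrite -hphi -ysectionE.
have hEx x : definable R2 (psi x @` D) (xsection E x).
  rewrite xsectionE; apply: gen_field_preimage hE; first exact: gen_field_is_field.
  move=> _ [c hc <-]; apply: sub_gen_field; exists (psi x c); first by exists c.
  by rewrite -hpsi -xsectionE.
have bEx x : BW (xsection E x).
  by apply: gen_field_min (hEx x) => // _ [c _ <-].
have hE' : definable R setT E.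
  by apply: gen_field_mono hE => _ [c _ <-]; exists c.
case: (hm) => _ _ /(_ _ _ _ hE' (fieldT hBV) (fieldT hBW)).
rewrite setXTT setIT => hint.
pose g y := \sum_(j < n) n%:R^-1 * \1_(xsection E (p j)) y : K.
pose v := \sum_(j < n) n%:R^-1 * nu (xsection E (p j)).
have hs : simple_integral BW nu g v.
  by exists n, (fun=> n%:R^-1), (fun j => xsection E (p j)).
have hg y : `|mu (ysection E y) - g y| < eps / 2.
  have := hp (ysection E y) (ex_intro _ _ (conj (cD _ _) (hEy y))).
  congr (`|_ - _| < _); rewrite /g -mulr_sumr -sum1_card natr_sum big_mkcond /=.
  congr (_ * _); apply: eq_bigr => j _.
  by rewrite indicE inE mem_ysection mem_xsection; case: (_ \in _).
have hg' y : \1_setT y * mu (setT `&` ysection E y) = mu (ysection E y).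
  by rewrite setTI indicT mul1r.
have l1 : m E <= v + eps / 2.
  apply: (has_integral_le hBW hnu hint hs) => y; rewrite hg'.
  by have := hg y; rewrite ltr_norml => /andP[]; lra.
have l2 : v <= m E + eps / 2.
  apply: (has_integral_ge hBW hnu hint hs) => y; rewrite hg'.
  by have := hg y; rewrite ltr_norml => /andP[]; lra.
pose grid : K := (n * n')%:R^-1 * \sum_i ((p i.1, q i.2) \in E)%:R.
have n0' : 0 < n%:R :> K by rewrite ltr0n.
have gridE : grid = \sum_(j < n) n%:R^-1 *
    (n'%:R^-1 * #|[pred k | q k \in xsection E (p j)]|%:R).
  rewrite /grid natrM invfM -mulr_sumr -mulrA -[in RHS]mulr_sumr; congr (_ * (_ * _)).
  rewrite -(pair_bigA _ (fun i j => ((p i, q j) \in E)%:R)) /=.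
  apply: eq_bigr => j _; rewrite -sum1_card natr_sum [in RHS]big_mkcond /=.
  by apply: eq_bigr => k _; rewrite inE mem_xsection; case: (_ \in _).
have l3 : `|v - grid| <= eps / 4.
  rewrite gridE -sumrB; apply: (le_trans (ler_norm_sum _ _ _)).
  have -> : eps / 4 = \sum_(j < n) n%:R^-1 * (eps / 4).
    by rewrite sumr_const card_ord -[RHS]mulr_natl mulrA mulfV ?mul1r ?gt_eqF.
  apply: ler_sum => j _; rewrite -mulrBr normrM ger0_norm ?invr_ge0 ?ler0n //.
  rewrite ler_wpM2l ?invr_ge0 ?ler0n //; apply/ltW.
  exact: hq (ex_intro _ _ (conj (cD _ _) (hEx (p j)))).
rewrite -/grid; move: l3; rewrite ler_norml => /andP[l3 l4].
by rewrite ltr_norml; apply/andP; split; lra.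
Qed.

End Fap.
End BinaryProduct.
(** * Coordinates of iterated products *)

Lemma no_shattering_of_vc_dim (T : Type) (F : set (set T)) (d : nat)
    (q : 'I_d.+1 -> T) : vc_dim_le F d ->
  ~ (forall J : {set 'I_d.+1}, exists2 X, F X & forall i, X (q i) <-> i \in J).
Proof.
move=> hF hq.
have qinj : injective q.
  move=> i i' e; have [X _ hX] := hq (finset.set1 i).
  have /hX : i \in finset.set1 i by rewrite finset.in_set1.
  by rewrite e => /hX; rewrite finset.in_set1 => /eqP.
apply: (hF (range q)).
  apply: card_eq_trans (inj_card_eq _) _; first by move=> i i' _ _; apply: qinj.
  by rewrite card_eq_sym; apply: card_II.
move=> S' hS'; have [X FX hX] := hq (finset.finset (fun i => q i \in S')).
exists X; split=> //; apply/seteqP; split=> x.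
  by move=> [Xx [i _ e]]; move: Xx; rewrite -e => /hX; rewrite finset.in_set => /set_mem.
move=> hx; have [i _ e] := hS' _ hx; split; last by exists i.
by rewrite -e; apply/hX; rewrite finset.in_set e; apply/mem_set.
Qed.

Section Coordinates.
Variables (n : nat) (V : 'I_n.+1 -> Type).
Local Notation U := (forall i, V i).
Local Notation upd := eqtype.dfwith.

(* Substitutes the coordinates of [x] for the coordinates [0, ..., j] of [z]. *)
Fixpoint glue (j : nat) : initprod V j -> U -> U :=
  match j return initprod V j -> U -> U with
  | 0 => fun x z => upd z x
  | j'.+1 => fun x z => glue x.1 (upd z x.2)
  end.

Lemma val_inord j : (j <= n)%N -> nat_of_ord (inord j : 'I_n.+1) = j.
Proof. by move=> h; rewrite inordK. Qed.

Lemma inord_neq j (i : 'I_n.+1) : (j <= n)%N -> j != i -> (inord j : 'I_n.+1) != i.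
Proof. by move=> hj; apply: contra => /eqP <-; rewrite val_inord. Qed.

Lemma glue_hi j (x : initprod V j) z (i : 'I_n.+1) : (j <= n)%N -> (j < i)%N ->
  glue x z i = z i.
Proof.
elim: j => [|j IH] in x z *; move=> hj hi /=.
  by rewrite dfwith_out // -val_eqE /= neq_ltn hi.
rewrite IH ?dfwith_out //; [|lia..].
by apply: inord_neq => //; rewrite neq_ltn hi.
Qed.

Lemma initproj_glue j (x : initprod V j) z : (j <= n)%N ->
  initproj j (glue x z) = x.
Proof.
elim: j => [|j IH] in x z *; move=> hj /=; first by rewrite dfwith_in.
case: x => x v; rewrite IH /=; last lia.
congr pair; rewrite glue_hi ?dfwith_in //; first lia.
by rewrite val_inord.
Qed.

Lemma glue_lo j u z z' (i : 'I_n.+1) : (j <= n)%N -> (i <= j)%N ->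
  glue (initproj j u) z i = u i /\ glue (initproj j u) z i = glue (initproj j u) z' i.
Proof.
suff H w : (j <= n)%N -> (i <= j)%N -> glue (initproj j u) w i = u i.
  by move=> hj hi; rewrite !H.
elim: j => [|j IH] in w *; move=> hj hi /=.
  have -> : i = ord0 by apply: val_inj => /=; lia.
  by rewrite dfwith_in.
have [hij|hij] := leqP i j; first by rewrite IH //; lia.
have <- : inord j.+1 = i by apply: val_inj => /=; rewrite val_inord //; lia.
by rewrite glue_hi ?dfwith_in //; [lia|rewrite val_inord].
Qed.

Lemma glue_initproj j u z : (j <= n)%N ->
  (forall i : 'I_n.+1, (j < i)%N -> z i = u i) -> glue (initproj j u) z = u.
Proof.
move=> hj h; apply: functional_extensionality_dep => i; have [hi|hi] := leqP i j.
  by have [] := glue_lo u z z hj hi.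
by rewrite glue_hi // h.
Qed.

Lemma glue_dfwith j (x : initprod V j) z (w : V (inord j.+1)) : (j < n)%N ->
  glue x (upd z w) = upd (glue x z) w.
Proof.
move=> hj; apply: functional_extensionality_dep => i.
have hj' : (j <= n)%N by lia.
have [hi|hi] := leqP i j.
  rewrite dfwith_out; last by apply: inord_neq => //; rewrite neq_ltn; lia.
  by rewrite -(initproj_glue x z hj'); have [_ ->] := glue_lo (glue x z) (upd z w) z hj' hi.
rewrite glue_hi //; have [<-|ne] := eqVneq (inord j.+1) i; first by rewrite !dfwith_in.
by rewrite !dfwith_out // glue_hi.
Qed.

Lemma restr_eqP (I : {set 'I_n.+1}) (u z : U) :
  restr I u = restr I z <-> forall i, i \in I -> u i = z i.
Proof.
split=> [h i hi|h]; last first.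
  by apply: functional_extensionality_dep => -[i hi]; apply: h.
exact: (congr1 (fun f : subprod V I => f (exist _ i hi)) h).
Qed.

(** Partial parameters can thus be written as restrictions of full points, and fibres computed by
    substituting coordinates. *)
Lemma restr_surj (x0 : U) (I : {set 'I_n.+1}) (b : subprod V I) :
  exists z, restr I z = b.
Proof.
exists (fun i => match pselect (i \in I) with
  | left h => b (exist _ i h) | right _ => x0 i end).
apply: functional_extensionality_dep => -[i hi]; rewrite /restr /=.
case: pselect => [h|] //.
by congr (b (exist _ i _)); apply: bool_irrelevance.
Qed.

Variable R : set U.

Lemma ysection_rel_init j z : (j <= n)%N ->
  ysection (rel_init R j) (restr _ z) = [set x | R (glue x z)].
Proof.
move=> hj; apply/seteqP; split=> x /=.
  move=> /ysectionP [u Ru [<- /restr_eqP h]].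
  by rewrite glue_initproj // => i hi; rewrite -h // finset.in_set.
move=> h; apply/ysectionP; exists (glue x z) => //; rewrite initproj_glue //.
by congr pair; apply/restr_eqP => i; rewrite finset.in_set => hi; rewrite glue_hi.
Qed.

Lemma ysection_rel_at1 i z :
  ysection (rel_at1 R i) (restr _ z) = [set v | R (upd z v)].
Proof.
apply/seteqP; split=> x /=.
  move=> /ysectionP [u Ru [<- /restr_eqP h]].
  rewrite (_ : upd _ _ = u) //; apply: functional_extensionality_dep => k.
  have [<-|ne] := eqVneq i k; first by rewrite dfwith_in.
  by rewrite dfwith_out // h // finset.in_setC finset.in_set1 eq_sym.
move=> h; apply/ysectionP; exists (upd z x) => //; rewrite dfwith_in; congr pair.
apply/restr_eqP => k; rewrite finset.in_setC finset.in_set1 eq_sym => hk.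
by rewrite dfwith_out.
Qed.

Lemma ysection_rel_at I u :
  ysection (rel_at R I) (restr (~: I)%SET u) (restr I u) <-> R u.
Proof.
split=> [/ysectionP [u' Ru' [/restr_eqP h1 /restr_eqP h2]]|h]; last first.
  by apply/ysectionP; exists u.
rewrite (_ : u = u') //; apply: functional_extensionality_dep => i.
case: (boolP (i \in I)) => hi; first by rewrite h1.
by rewrite h2 // finset.in_setC.
Qed.

(** Fixing the last coordinate of a fibre yields a fibre one level down, with that coordinate moved
    into the base point. This is what lets the induction apply to the fibres at representatives. *)
Lemma ysection_fibre j z y : (j < n)%N ->
  ysection (ysection (rel_init R j.+1) (restr _ z)) y =
  ysection (rel_init R j) (restr _ (upd z y)).
Proof.
move=> hj; rewrite !ysection_rel_init //; last by lia.
by apply/seteqP; split=> x; [move/ysectionP|move=> h; apply/ysectionP].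
Qed.

(** Hence sets definable from sections at sample points are definable over points [glue x z] in the
    sense of the theorem. *)
Lemma xsection_fibre j z (x : initprod V j) : (j < n)%N ->
  xsection (ysection (rel_init R j.+1) (restr _ z)) x =
  ysection (rel_at1 R (inord j.+1)) (restr _ (glue x z)).
Proof.
move=> hj; rewrite ysection_rel_init // ysection_rel_at1.
by apply/seteqP; split=> y /=; [move=> /xsectionP|move=> h; apply/xsectionP; move: h];
  rewrite /= glue_dfwith.
Qed.

Fixpoint box (j : nat) (X : forall i, set (V i)) : set (initprod V j) :=
  match j return set (initprod V j) with
  | 0 => X ord0
  | j'.+1 => @box j' X `*` X (inord j'.+1)
  end.

Lemma box_initproj j X u : (j <= n)%N ->
  @box j X (initproj j u) <-> forall i : 'I_n.+1, (i <= j)%N -> X i (u i).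
Proof.
elim: j => [|j IH] hj /=.
  split=> [h i hi|]; last by apply.
  by have -> : i = ord0 by apply: val_inj => /=; lia.
split=> [[/= /IH h1 h2] i|h].
  rewrite leq_eqVlt => /orP[/eqP e|hi].
    by have <- : inord j.+1 = i by apply: val_inj => /=; rewrite val_inord.
  by apply: h1; lia.
split=> /=; last by apply: h; rewrite val_inord.
by apply/IH => [|i hi]; [lia|apply: h; lia].
Qed.

Lemma eq_box j X Y : (j <= n)%N ->
  (forall i : 'I_n.+1, (i <= j)%N -> X i = Y i) -> @box j X = @box j Y.
Proof.
elim: j => [|j IH] hj h /=; first exact: h.
by congr (_ `*` _); [apply: IH => [|i hi]; [lia|apply: h; lia]|apply: h; rewrite val_inord].
Qed.

(** A shattered tuple of the initial product would give one in V_I for I = {0, ..., j}, shattered by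
    the fibres of R at the points [upd z y]. *)
Lemma no_shattering_fibre d j z : (j < n)%N -> rel_vc_dim_le R d ->
  no_shattering (ysection (rel_init R j.+1) (restr _ z)) d.
Proof.
move=> hj hR [q hq]; pose I : {set 'I_n.+1} := finset.finset (fun i : 'I_n.+1 => (i <= j)%N).
have hj' : (j <= n)%N by lia.
apply: (no_shattering_of_vc_dim (q := fun k => restr I (glue (q k) z)) (hR I)) => J.
have [y hy] := hq J.
exists (ysection (rel_at R I) (restr (~: I)%SET (upd z y))); first by eexists.
move=> k; pose u := glue (q k) (upd z y).
have -> : restr I (glue (q k) z) = restr I u.
  apply/restr_eqP => i; rewrite finset.in_set => hi.
  rewrite /u -(initproj_glue (q k) z hj').
  by have [_ ->] := glue_lo (glue (q k) z) (upd z y) z hj' hi; rewrite initproj_glue.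
have -> : restr (~: I)%SET (upd z y) = restr (~: I)%SET u.
  apply/restr_eqP => i; rewrite finset.in_setC finset.in_set -ltnNge => hi.
  by rewrite /u glue_hi.
rewrite ysection_rel_at -hy finset.in_set ysection_rel_init //.
by split=> [h|/set_mem //]; apply/mem_set.
Qed.

End Coordinates.
(** * Induction on the number of factors *)

Lemma fap_transport (K : realType) (V Z Z' : Type) (R : set (V * Z))
    (R' : set (V * Z')) (phi : Z' -> Z) (mu : set V -> K) :
  (forall c, ysection R' c = ysection R (phi c)) -> fap R mu -> fap R' mu.
Proof.
move=> h hf m e e0; have [k [k0 [p hp]]] := hf m e e0.
exists k; split=> //; exists p => A [D [cD dA]]; apply: hp.
exists (phi @` D); split; first exact: card_le_trans (card_image_le _ _) cD.
apply: gen_field_mono dA => _ [c hc <-]; exists (phi c); first by exists c.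
by rewrite h.
Qed.

Lemma fap_dist (K : realType) (V W Z : Type) (R : set (V * Z)) (S : set (V * W))
    (phi : W -> Z) (mu : set V -> K) :
  (forall y, ysection S y = ysection R (phi y)) -> fap R mu ->
  finitely_approx_dist S mu.
Proof.
move=> h hf dist e e0; have [k [k0 [p hp]]] := hf 2%N e e0.
exists k; split=> //; exists p => y y'; apply: hp.
(* As an image of [I_2], the pair has at most two elements even when the two parameters coincide. *)
exists ((fun i => if i == 0%N then phi y else phi y') @` `I_2); split.
  exact: card_image_le.
have hG := gen_field_is_field (ysection R @` ((fun i => if i == 0%N then phi y else phi y') @` `I_2)).
apply: (fieldY hG); apply: sub_gen_field; rewrite h.
  by exists (phi y) => //; exists 0%N.
by exists (phi y') => //; exists 1%N.
Qed.

(** Each step multiplies by the number of classes, with constant [C], and works at precision e/4,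
    whence the power of 4. *)
Fixpoint approx_constant (K : realType) (d : nat) (C : K) (j : nat) : K :=
  if j is j'.+1 then C * approx_constant d C j' * 4 ^+ (2 * j * d) else 1.

Lemma approx_constant_ge1 (K : realType) d (C : K) j : 1 <= C -> 1 <= approx_constant d C j.
Proof.
move=> C1; elim: j => //= j IH.
by rewrite mulr_ege1 ?mulr_ege1 // exprn_ege1 // ler1n.
Qed.

Section IteratedProduct.
Variables (K : realType) (n : nat) (V : 'I_n.+1 -> Type) (R : set (forall i, V i)).
Variables (B : forall i, set (set (V i))) (mu : forall i, set (V i) -> K).
Local Notation U := (forall i, V i).
Local Notation upd := eqtype.dfwith.
Local Notation BF j := (@init_field n V R B j).
Local Notation MM j := (@init_measure n V K R B mu j).
Hypothesis hB : forall i, is_field (@B i).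
Hypothesis hRB : forall i (b : subprod V (~: [set i]%SET)),
  @B i (ysection (rel_at1 R i) b).
Hypothesis hmu : forall i, is_measure (@B i) (@mu i).
Hypothesis hfap : forall i, fap (rel_at1 R i) (@mu i).

Definition lprod_spec j :=
  is_lprod (rel_init R j.+1 : set (initprod V j * V (inord j.+1) * _))
    (BF j) (MM j) (@B (inord j.+1)) (@mu (inord j.+1)) (MM j.+1).

Lemma lprod_spec_or0 j : lprod_spec j \/ MM j.+1 = (fun=> 0).
Proof.
have [[m hm]|hn] := pselect (exists m, is_lprod
    (rel_init R j.+1 : set (initprod V j * V (inord j.+1) * _))
    (BF j) (MM j) (@B (inord j.+1)) (@mu (inord j.+1)) m).
  by left; exact: xgetI hm.
by right; apply: xgetPN => m hm; apply: hn; exists m.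
Qed.

Lemma init_field_is_field j : is_field (BF j).
Proof. by case: j => [|j]; [apply: hB|apply: gen_field_is_field]. Qed.

(* If the product failed to exist at level [j], it would be the default value 0,
   and 0 has no product with a probability measure. *)
Lemma lprod_spec_pred j : lprod_spec j.+1 -> lprod_spec j.
Proof.
move=> h; case: (lprod_spec_or0 j) => // h0; case: h => -[h1 _ _].
move=> /(_ setT setT (fieldT (init_field_is_field _)) (fieldT (hB _))).
by rewrite setXTT h1 h0 mul0r => /eqP; rewrite oner_eq0.
Qed.

Lemma lprod_spec_le i j : (i <= j)%N -> lprod_spec j -> lprod_spec i.
Proof.
move=> hij; rewrite -(subnKC hij); elim: (j - i)%N => [|k IH]; first by rewrite addn0.
by rewrite addnS => /lprod_spec_pred.
Qed.

Lemma exists_point : exists x : U, True.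
Proof.
have h i : exists x : V i, True := fmeasure_nonempty (hB i) (hmu i).
by exists (fun i => proj1_sig (cid (h i))).
Qed.

Lemma init_field_fibre j z : (j <= n)%N ->
  BF j (ysection (rel_init R j) (restr _ z)).
Proof.
case: j => [|j] hj; last by apply: sub_gen_field; right; eexists.
by rewrite ysection_rel_init //; have := @hRB ord0 (restr _ z); rewrite (ysection_rel_at1 R ord0).
Qed.

Lemma init_field_box j X : (forall i, @B i (X i)) -> BF j (@box n V j X).
Proof.
by move=> hX; elim: j => [|j IH] /=; [apply: hX|apply: lprod_field_box].
Qed.

Hypothesis hprod : forall j, (j < n)%N -> lprod_spec j.

Lemma init_measure_is_measure j : (j <= n)%N -> is_measure (BF j) (MM j).
Proof.
by case: j => [|j] hj; [apply: hmu|case: (hprod hj)].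
Qed.

(** Induction through [fap_lprod], whose section hypotheses are [ysection_fibre] and
    [xsection_fibre]; parameters are first extended to full points. *)
Lemma fap_init j : (j <= n)%N -> fap (rel_init R j) (MM j).
Proof.
have [x0 _] := exists_point.
have ext I : exists f : subprod V I -> U, forall b, restr I (f b) = b.
  by have [f hf] := choice (restr_surj x0 (I := I)); exists f.
elim: j => [|j IH] hj.
  have [f hf] := ext (finset.finset (fun i : 'I_n.+1 => (0 < i)%N)).
  apply: (fap_transport (phi := fun c => restr _ (f c))) (@hfap ord0) => c.
  by rewrite ysection_rel_at1 -{1}(hf c); apply: (@ysection_rel_init _ _ R 0).
have hj' : (j <= n)%N by lia.
have [f hf] := ext (finset.finset (fun i : 'I_n.+1 => (j.+1 < i)%N)).
have e1 y c : ysection (ysection (rel_init R j.+1) c) y =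
    ysection (rel_init R j) (restr _ (upd (f c) y)).
  by rewrite -{1}(hf c) ysection_fibre.
have e2 (x : initprod V j) c : xsection (ysection (rel_init R j.+1) c) x =
    ysection (rel_at1 R (inord j.+1)) (restr _ (glue x (f c))).
  by rewrite -{1}(hf c) xsection_fibre.
exact: (fap_lprod (init_field_is_field j) (hB (inord j.+1)) (hmu (inord j.+1))
  (hprod hj) e1 e2 (@hRB (inord j.+1)) (IH hj') (@hfap (inord j.+1))).
Qed.

(* A union of boxes whose [i]-th sides are definable over [M] points [h i s],
   [s < M], approximates the fibre of R at [z] up to [e]; the coordinates of [z]
   and the sides of index [> j] are irrelevant. *)
Definition box_approx j (z : U) (e : K) (M : nat) :=
  exists (h : forall i : 'I_n.+1, nat -> U)
    (X : {N : nat & 'I_N -> forall i, set (V i)}),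
  (forall t i, definable (rel_at1 R i) ((fun s => restr _ (h i s)) @` `I_M)
     (projT2 X t i)) /\
  MM j (ysection (rel_init R j) (restr _ z) `+`
        [set x | exists t, @box n V j (projT2 X t) x]) <= e.

Lemma field_definable i D A : definable (rel_at1 R i) D A -> @B i A.
Proof. by apply: gen_field_min => // _ [c _ <-]; apply: hRB. Qed.

Lemma definable_image_mono i (h h' : nat -> U) M M' A :
  (forall s, (s < M)%N -> exists2 s', (s' < M')%N & h' s' = h s) ->
  definable (rel_at1 R i) ((fun s => restr _ (h s)) @` `I_M) A ->
  definable (rel_at1 R i) ((fun s => restr _ (h' s)) @` `I_M') A.
Proof.
move=> H; apply: gen_field_mono => _ [_ [s hs <-] <-].
have [s' hs' e] := H s hs; exists (restr _ (h' s')); last by rewrite e.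
by exists s'.
Qed.

Lemma box_approx_mono j z e M M' : (M <= M')%N ->
  box_approx j z e M -> box_approx j z e M'.
Proof.
move=> hM [h [X [h1 h2]]]; exists h, X; split=> // t i.
apply: definable_image_mono (h1 t i) => s hs; exists s => //.
exact: leq_trans hM.
Qed.

Lemma box_approx0 z e : 0 <= e -> box_approx 0 z e 1.
Proof.
move=> e0; pose X1 := upd (fun i => [set: V i]) (i := ord0)
  (ysection (rel_at1 R ord0) (restr _ z)).
exists (fun _ _ => z), (existT _ 1%N (fun=> X1)); split=> /=.
  move=> _ i; have hG := gen_field_is_field.
  have [<-|ne] := eqVneq ord0 i.
    rewrite /X1 dfwith_in; apply: sub_gen_field; exists (restr _ z) => //.
    by exists 0%N.
  by rewrite /X1 dfwith_out //; apply: fieldT; apply: gen_field_is_field.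
rewrite (_ : _ `+` _ = set0) ?(fmeasure0 (@hB ord0) (@hmu ord0)) //.
rewrite (@ysection_rel_init _ _ R 0 z (leq0n n)) /X1 dfwith_in ysection_rel_at1.
by apply/seteqP; split=> // x [[h1 h2]|[[_ h1] h2]] //; case: h2; exists ord0.
Qed.

(** Each class is multiplied by the boxes approximating the fibre at its representative. The new
    side uses the [m] sample points; a lower side pools [M] parameters from each of at most [N]
    classes. Hence the maximum. *)
Lemma box_approxS j z e m N M (P : 'I_m -> initprod V j) (F : finType)
    (pi : V (inord j.+1) -> F) (b : F -> V (inord j.+1)) T :
  let S : set (initprod V j * V (inord j.+1)) :=
    ysection (rel_init R j.+1) (restr _ z) in
  (j < n)%N -> 0 <= e -> (#|F| <= N)%N ->
  (forall c, gen_field (range (fun i => xsection S (P i))) (pi @^-1` [set c])) ->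
  @B _ T -> mu T <= e ->
  (forall y, ~ T y -> MM j (ysection S y `+` ysection S (b (pi y))) <= e) ->
  (forall c, box_approx j (upd z (b c)) e M) ->
  box_approx j.+1 z (4 * e) (maxn m (N * M)).
Proof.
move=> S hj e0 hN dpi hT nT hb hA.
have hj' : (j <= n)%N by lia.
have [h hh] := choice hA.
have {hh}[X hX] := choice hh.
(* A new box is indexed by a class and one of the boxes chosen for that class. *)
pose J := {c : F & 'I_(projT1 (X c))}.
pose X' (ct : J) : forall i, set (V i) :=
  upd (projT2 (X (tag ct)) (tagged ct)) (i := inord j.+1) (pi @^-1` [set tag ct]).
(* The pairs (c, s), c in F and s < M, are encoded as [index c (enum F) * M + s]. *)
pose h' i s := if i == inord j.+1
  then if insub s is Some k then glue (P k) z else z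
  else if onth (enum F) (s %/ M)%N is Some c then h c i (s %% M)%N else z.
exists h', (existT (fun N => 'I_N -> forall i, set (V i)) #|{: J}|
  (fun t : 'I_#|{: J}| => X' (enum_val t))); split=> /=.
  move=> t i; move: (enum_val t) => [c k]; rewrite /X' /=.
  have [<-|ne] := eqVneq (inord j.+1) i.
    rewrite dfwith_in; apply: gen_field_mono (dpi c) => _ [s _ <-].
    rewrite xsection_fibre //; eexists; last by [].
    exists (val s); first exact: leq_trans (ltn_ord s) (leq_maxl _ _).
    by rewrite /h' eqxx valK.
  rewrite dfwith_out //; have [h1 _] := hX c; apply: definable_image_mono (h1 k i) => s hs.
  exists (index c (enum F) * M + s)%N; last first.
    rewrite /h' eq_sym (negbTE ne) onthE divnMDl ?divn_small ?addn0; try lia.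
    rewrite (nth_map c) ?index_mem ?mem_enum // nth_index ?mem_enum //.
    by rewrite modnMDl modn_small.
  have hc : (index c (enum F) < #|F|)%N by rewrite cardE index_mem mem_enum.
  apply: leq_trans (leq_maxr _ _); have : (#|F| * M <= N * M)%N by rewrite leq_mul2r hN orbT.
  by apply: leq_trans; nia.
pose A c := [set x | exists t, @box n V j (projT2 (X c) t) x].
have BA c : BF j (A c).
  have [h1 _] := hX c.
  have hbx t : BF j (@box n V j (projT2 (X c) t)).
    by apply: init_field_box => i; apply: field_definable (h1 t i).
  have := field_bigcup (init_field_is_field j) predT hbx.
  rewrite (_ : [set x | _] = A c) //.
  by apply/seteqP; split=> x [t]; exists t.
have eA : [set x | exists t : 'I_#|{: J}|, @box n V j.+1 (X' (enum_val t)) x] =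
    [set x | A (pi x.2) x.1].
  pose tg c (k : 'I_(projT1 (X c))) : J := Tagged (fun c => 'I_(projT1 (X c))) k.
  have bx c k : @box n V j (X' (tg c k)) = @box n V j (projT2 (X c) k).
    apply: eq_box => // i hi; rewrite /X' dfwith_out //; apply: inord_neq => //.
    by rewrite neq_ltn; lia.
  have bx' c k : X' (tg c k) (inord j.+1) = pi @^-1` [set c] by rewrite /X' dfwith_in.
  apply/seteqP; split=> -[x y] /=.
    move=> [t]; move: (enum_val t) => [c k]; rewrite -/(tg c k) => -[/=].
    by rewrite bx bx' => h1 /= h2; rewrite h2; exists k.
  move=> [k hk]; exists (enum_rank (tg _ k)).
  by rewrite enum_rankK; split=> /=; rewrite ?bx ?bx'.
rewrite eA.
apply: (lprod_approx_le (init_field_is_field j) (init_measure_is_measure hj')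
  (hB _) (hmu _) (hprod hj) (b := b) e0 _ _ hT nT hb) => //.
- by move=> y; rewrite ysection_fibre //; apply: init_field_fibre.
- move=> c; apply: (gen_field_min (hB _)) (dpi c) => _ [s _ <-].
  by rewrite xsection_fibre.
- by move=> c; have [_] := hX c; rewrite ysection_fibre.
Qed.

Lemma xsection_fibre_field j z (x : initprod V j) : (j < n)%N ->
  @B (inord j.+1) (xsection (ysection (rel_init R j.+1) (restr _ z)) x).
Proof. by move=> hj; rewrite xsection_fibre. Qed.

Lemma fibre_finitely_approx_dist j z : (j < n)%N ->
  finitely_approx_dist (ysection (rel_init R j.+1) (restr _ z)) (MM j).
Proof.
move=> hj; have hj' : (j <= n)%N by lia.
apply: (fap_dist (phi := fun y => restr _ (upd z y))) (fap_init hj') => y.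
by rewrite ysection_fibre.
Qed.
Lemma exists_box_approx j z e : (j <= n)%N -> 0 < e -> exists M, box_approx j z e M.
Proof.
elim: j => [|j IH] in z e *; move=> hj e0; first by exists 1%N; apply: box_approx0; apply: ltW.
have e4 : 0 < e / 4 by rewrite divr_gt0.
have hj' : (j <= n)%N by lia.
have [m [N [P [F [pi [b [T [hN dpi hT nT hb]]]]]]]] :=
  exists_approx_partition (hB _) (hmu (inord j.+1))
    (fibre_finitely_approx_dist z hj) e4.
have [M hM] := choice (fun c : F => IH (upd z (b c)) (e / 4) hj' e4).
exists (maxn m (N * \max_c M c)).
have -> : e = 4 * (e / 4) by lra.
apply: (box_approxS hj (ltW e4) hN dpi hT nT hb) => c.
by apply: box_approx_mono (hM c); apply: leq_bigmax.
Qed.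

Section Bounds.
Variables (d : nat) (C : K).
Hypothesis C1 : 1 <= C.
Hypothesis hC : forall eps : K, 0 < eps -> eps <= 1 -> exists m : nat,
  [/\ m%:R <= C * eps^-1 ^+ 2, m.+1%:R ^+ d <= C * eps^-1 ^+ (2 * d)
    & (1 - eps / 2) ^+ m * m.+1%:R ^+ d <= eps ^+ 2].

(** [M] is uniform in [z] because the induction hypothesis is applied at the base points of all
    classes at once. *)
Lemma exists_box_approx_vc j e : (0 < d)%N -> rel_vc_dim_le R d -> (j <= n)%N ->
  0 < e -> e <= 1 ->
  exists M, M%:R <= approx_constant d C j * e^-1 ^+ (2 * j * d) /\
    forall z, box_approx j z e M.
Proof.
move=> d0 hR; elim: j => [|j IH] in e *; move=> hj e0 e1.
  exists 1%N; split=> [|z]; last by apply: box_approx0; apply: ltW.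
  by rewrite muln0 mul0n expr0 mulr1.
pose e' := e / 4.
have e'0 : 0 < e' by rewrite divr_gt0.
have e'1 : e' <= 1 by rewrite /e'; lra.
have hj' : (j <= n)%N by lia.
have [m [m1 m2 m3]] := hC e'0 e'1.
have [M [M1 M2]] := IH e' hj' e'0 e'1.
exists (maxn m (m.+1 ^ d * M)); split; last first.
  move=> z; have [P [F [pi [b [T [hN dpi hT nT hb]]]]]] :=
    exists_approx_partition_vc (hB _) (hmu (inord j.+1))
      (fun x => xsection_fibre_field z x hj) (no_shattering_fibre (z := z) hj hR)
      (fibre_finitely_approx_dist z hj) e'0 e'1 m3.
  have -> : e = 4 * e' by rewrite /e'; lra.
  by apply: (box_approxS hj (ltW e'0) hN dpi hT nT hb) => c.
have t1 : 1 <= e'^-1 by rewrite invf_ge1.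
have t0 : 0 <= e'^-1 by rewrite invr_ge0 ltW.
have c1 := approx_constant_ge1 d j C1.
have -> : approx_constant d C j.+1 * e^-1 ^+ (2 * j.+1 * d) =
    C * approx_constant d C j * e'^-1 ^+ (2 * j.+1 * d).
  rewrite /e' invfM invrK exprMn /=; ring.
rewrite /maxn; case: ifP => _.
  rewrite natrM natrX.
  apply: (@le_trans _ _ ((C * e'^-1 ^+ (2 * d)) *
      (approx_constant d C j * e'^-1 ^+ (2 * j * d)))).
    by rewrite ler_pM // ?exprn_ge0 ?ler0n.
  rewrite le_eqVlt; apply/orP; left; apply/eqP.
  have -> : (2 * j.+1 * d = 2 * d + 2 * j * d)%N by rewrite mulnS mulnDl.
  rewrite exprD; ring.
(* When the sample size is the larger term, its exponent 2 must not exceed [2 * j.+1 * d]; this is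
   where [d > 0] enters. *)
apply: (le_trans m1); rewrite -mulrA ler_wpM2l //; first exact: le_trans C1.
apply: (@le_trans _ _ (e'^-1 ^+ (2 * j.+1 * d))).
  by rewrite ler_weXn2l // -mulnA leq_pmulr // muln_gt0.
by rewrite ler_peMl ?exprn_ge0.
Qed.

End Bounds.

Lemma image_initproj z (E : set U) : initproj n @` E = [set x | E (glue x z)].
Proof.
apply/seteqP; split=> x /=.
  move=> [u Eu <-]; rewrite glue_initproj // => i.
  by have := ltn_ord i; lia.
by move=> h; exists (glue x z) => //; rewrite initproj_glue.
Qed.

(** At level [n] no coordinate of [z] remains, so the fibre at [z] is R itself, carried along
    [initproj n]. *)
Lemma tensor_of_box_approx z e M : box_approx n z e M ->
  exists D A, [/\ tensor_definable R D A, iter_lprod R B mu (R `+` A) <= e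
    & forall i, (D i #<= `I_M)%card].
Proof.
move=> [h [[N X] /= [h1 h2]]].
exists (fun i => (fun s => restr _ (h i s)) @` `I_M).
exists [set x | exists t, forall i, X t i (x i)]; split.
- by exists N, X.
- move: h2; congr (_ <= _); rewrite /iter_lprod (image_initproj z); congr (MM n _).
  rewrite ysection_rel_init // (_ : [set x | exists t, @box n V n (X t) x] =
    [set x | exists t, forall i, X t i (glue x z i)]) //.
  have bx x t : @box n V n (X t) x <-> forall i, X t i (glue x z i).
    rewrite -[X in box _ X](initproj_glue x z (leqnn n)).
    split=> [/(box_initproj _ _ (leqnn n)) H i|H]; first by apply: H; rewrite -ltnS.
    by apply/(box_initproj _ _ (leqnn n)).
  by apply/seteqP; split=> x [t] ht; exists t; apply/bx.
- by move=> i; apply: card_image_le.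
Qed.

Lemma iter_lprod_le1 : iter_lprod R B mu R <= 1.
Proof.
have [z _] := exists_point.
rewrite /iter_lprod (image_initproj z) -(ysection_rel_init R z (leqnn n)).
apply: (fmeasure_le1 (init_field_is_field n) (init_measure_is_measure (leqnn n))).
exact: init_field_fibre.
Qed.

Lemma iter_lprod0 : iter_lprod R B mu set0 = 0.
Proof.
rewrite /iter_lprod image_set0.
exact: (fmeasure0 (init_field_is_field n) (init_measure_is_measure (leqnn n))).
Qed.

End IteratedProduct.

(** * Degenerate cases and the final bound *)

Lemma rel_vc_dim_le0 (n : nat) (V : 'I_n.+1 -> Type) (R : set (forall i, V i)) :
  rel_vc_dim_le R 0 -> R = set0 \/ R = setT.
Proof.
move=> hR; have [[u Ru]|hn] := pselect (exists u, R u); last first.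
  by left; apply/seteqP; split=> // u Ru; apply: hn; exists u.
right; apply/seteqP; split=> // u' _; apply: contrapT => nRu'.
(* The product over the empty index set is a single point, shattered as soon as R and its complement
   are both nonempty. *)
pose I : {set 'I_n.+1} := finset.set0.
apply: (no_shattering_of_vc_dim (q := fun=> restr I u) (hR I)) => J.
exists (ysection (rel_at R I) (restr (~: I)%SET (if ord0 \in J then u else u'))).
  by eexists.
move=> i; rewrite (ord1 i).
have e w : restr I u = restr I w by apply/restr_eqP => k; rewrite finset.in_set0.
by case: (boolP (ord0 \in J)) => hJ; [rewrite ysection_rel_at|rewrite (e u') ysection_rel_at].
Qed.

Section Dichotomy.
Variables (K : realType) (n : nat) (V : 'I_n.+1 -> Type) (R : set (forall i, V i)).
Variables (B : forall i, set (set (V i))) (mu : forall i, set (V i) -> K).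
Hypothesis hB : forall i, is_field (@B i).

Lemma lprod_spec_or_iter_lprod0 :
  (forall j, (j < n)%N -> lprod_spec R B mu j) \/ forall E, iter_lprod R B mu E = 0.
Proof.
have [h|h] : (forall j, (j < n)%N -> lprod_spec R B mu j) \/
    forall X, @init_measure n V K R B mu n X = 0.
  (* The type of [V] mentions [n], so the case analysis is made on a separate [k]. *)
  have H k : k = n -> (forall j, (j < k)%N -> lprod_spec R B mu j) \/
      forall X, @init_measure n V K R B mu k X = 0.
    case: k => [|k] _; first by left.
    have [h|h] := lprod_spec_or0 R B mu k; last by right => X; rewrite h.
    by left => j hj; apply: lprod_spec_le h.
  exact: (H n).
- by left.
- by right => E; apply: h.
Qed.

End Dichotomy.

Lemma tensor_definable_set0 (n : nat) (V : 'I_n.+1 -> Type) (R : set (forall i, V i)) D :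
  tensor_definable R D set0.
Proof.
exists 0%N, (fun _ _ => setT); split; first by case.
by apply/seteqP; split=> // x [[]].
Qed.

Lemma tensor_definable_setT (n : nat) (V : 'I_n.+1 -> Type) (R : set (forall i, V i)) D :
  tensor_definable R D setT.
Proof.
exists 1%N, (fun _ _ => setT); split.
  by move=> _ i; apply: fieldT; apply: gen_field_is_field.
by apply/seteqP; split=> // x _; exists ord0.
Qed.

Lemma tuple_norm_le0 (K : realType) (n : nat) (V : 'I_n.+1 -> Type) (c : K) :
  0 <= c -> tuple_norm_le (fun i => set0 : set (subprod V (~: [set i])%SET)) c.
Proof. by move=> c0 i; exists 0%N; split=> //; apply: card_ge0. Qed.

(* The number k of factors is n.+1, so that k - 1 is n. *)
Theorem mainTheorem2 (K : realType) (n d : nat) :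
  exists C : K,
  forall (V : 'I_n.+1 -> Type) (R : set (forall i, V i))
    (B : forall i, set (set (V i))) (mu : forall i, set (V i) -> K),
    (forall i, is_field (B i)) ->
    (forall i (b : subprod V (~: [set i]%SET)),
        B i (ysection (rel_at1 R i) b)) ->
    (forall i, is_measure (B i) (mu i)) ->
    (forall i, fap (rel_at1 R i) (mu i)) ->
    forall eps : K, 0 < eps ->
      (exists D A, tensor_definable R D A /\
         iter_lprod R B mu (R `+` A) < eps)
      /\
      (rel_vc_dim_le R d ->
       exists D A, [/\ tensor_definable R D A,
         iter_lprod R B mu (R `+` A) < eps
         & tuple_norm_le D (C * eps^-1 ^+ (2 * n * d))]).
Proof.
have [C0 C01 hC0] := exists_sample_size K d.
pose a := approx_constant d C0 n; have a1 : 1 <= a by apply: approx_constant_ge1.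
(* The power of 2 pays for working at eps/2, which makes the final inequality strict. *)
exists (a * 2 ^+ (2 * n * d)) => V R B mu hB hRB hmu hfap eps eps0.
set c := _ * eps^-1 ^+ _.
have c0 : 0 <= c.
  by rewrite !mulr_ge0 ?exprn_ge0 ?invr_ge0 ?ler0n ?(ltW eps0) //; apply: le_trans a1.
have e2 : 0 < eps / 2 by rewrite divr_gt0.
have e2lt : eps / 2 < eps by rewrite ltr_pdivrMr // ltr_pMr // ltr1n.
have [hprod|h0] := lprod_spec_or_iter_lprod0 R mu hB; last first.
  split=> [|_]; exists (fun=> set0), set0; rewrite h0; split=> //.
  - exact: tensor_definable_set0.
  - exact: tensor_definable_set0.
  - exact: tuple_norm_le0.
have [z _] := exists_point hB hmu.
split=> [|hR].
  have [M hM] := exists_box_approx hB hRB hmu hfap hprod z (leqnn n) e2.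
  have [D [A [hA hle _]]] := tensor_of_box_approx hM.
  by exists D, A; split=> //; apply: le_lt_trans e2lt.
(* The sample size is available only for precision at most 1; for larger [eps] the empty set
   suffices, as R has measure at most 1. *)
have [e1|e1] := ltP 1 eps.
  exists (fun=> set0), set0; split; [exact: tensor_definable_set0| |exact: tuple_norm_le0].
  by rewrite setY0; apply: le_lt_trans e1; apply: iter_lprod_le1.
(* For [d = 0] the required bound does not depend on [eps], which sampling cannot give; but then R
   is empty or full. *)
have [d0|d0] := posnP d.
  have hR0 : R = set0 \/ R = setT by apply: rel_vc_dim_le0; rewrite -d0.
  exists (fun=> set0), R; split; last exact: tuple_norm_le0.
    by case: hR0 => ->; [apply: tensor_definable_set0|apply: tensor_definable_setT].
  by rewrite setYK iter_lprod0.
have e21 : eps / 2 <= 1 by apply: le_trans (ltW e2lt) e1.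
have [M [hM1 hM2]] :=
  exists_box_approx_vc hB hRB hmu hfap hprod C01 hC0 d0 hR (leqnn n) e2 e21.
have [D [A [hA hle hD]]] := tensor_of_box_approx (hM2 z).
exists D, A; split=> //; first exact: le_lt_trans e2lt.
move=> i; exists M; split; first exact: hD.
by apply: (le_trans hM1); rewrite invfM invrK exprMn mulrA mulrAC.
Qed.
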